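(* Let $(\mathfrak g=\mathfrak k\oplus\mathfrak p,\langle\cdot,\cdot\rangle)$ be a metric reductive decomposition such that $B(\mathfrak k,\mathfrak p)=0$, obtained by the construction described in the context from data $(\mathfrak n,\langle\cdot,\cdot\rangle_{\mathfrak n})$, $(\mathfrak u=\mathfrak k\oplus\mathfrak h,\langle\cdot,\cdot\rangle_{\mathfrak u})$, $\theta$, with constant $c<0$ and derivation $D_1$ of $\mathfrak n$. Assume that it is an algebraic soliton with $\operatorname{Ric}=cI+D_{\mathfrak p}$, where $D=S(D)\in\operatorname{Der}(\mathfrak g)$ is given by $D=-S(\operatorname{ad}H)+\begin{bmatrix}0&&\\&0&\\&&D_1\end{bmatrix}$ (blocks with respect to $\mathfrak g=\mathfrak k\oplus\mathfrak h\oplus\mathfrak n$). Let $\mathfrak g_0:=\{H\}^\perp\subset\mathfrak g$, a unimodular ideal. (i) If $\mathfrak g$ is non-unimodular, consider the new Lie algebra $\tilde{\mathfrak g}$ with underlying vector space $\mathfrak g=\mathbb RH\oplus\mathfrak g_0$ and Lie bracket defined by keeping that of $\mathfrak g$ on $\mathfrak g_0$ and only replacing the adjoint action of $H$ on $\mathfrak g_0$ by $$\operatorname{ad}_{\tilde{\mathfrak g}}H:=\alpha\,(S(\operatorname{ad}_{\mathfrak g}H)+D)=\alpha\begin{bmatrix}0&&\\&0&\\&&D_1\end{bmatrix},\qquad \alpha=\frac{\|H\|}{(\operatorname{tr}D_1)^{1/2}}.$$ Then the metric reductive decomposition $(\tilde{\mathfrak g}=\mathfrak k\oplus\mathfrak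 p,\langle\cdot,\cdot\rangle)$ is Einstein with Ricci operator $\widetilde{\operatorname{Ric}}=cI$. (ii) The metric reductive decomposition $(\mathfrak g_0=\mathfrak k\oplus\mathfrak p_0,\langle\cdot,\cdot\rangle|_{\mathfrak g_0\times\mathfrak g_0})$, where $\mathfrak p_0:=\mathfrak p\cap\{H\}^\perp$, is also an algebraic soliton, with $$\operatorname{Ric}_{\mathfrak g_0}=cI+D'_{\mathfrak p_0},\qquad\text{where } D':=D|_{\mathfrak g_0}+S(\operatorname{ad}H)|_{\mathfrak g_0}\in\operatorname{Der}(\mathfrak g_0)$$ and $D'_{\mathfrak p_0}=D'|_{\mathfrak p_0}$. (iii) If $\mathfrak g$ is unimodular, consider the semidirect product $\tilde{\mathfrak g}=\mathbb RA\oplus\mathfrak g$, with $$\operatorname{ad}_{\tilde{\mathfrak g}}A:=\alpha D=\alpha\begin{bmatrix}0&&\\&0&\\&&D_1\end{bmatrix}\ \text{ on }\mathfrak g,\qquad\alpha=\frac1{(\operatorname{tr}D_1)^{1/2}}.$$ Then the metric reductive decomposition $(\tilde{\mathfrak g}=\mathfrak k\oplus\tilde{\mathfrak p},\langle\cdot,\cdot\rangle)$, where $\tilde{\mathfrak p}:=\mathbb RA\oplus\mathfrak p$ and $\|A\|=1$, $\langle A,\mathfrak p\rangle=0$, is Einstein with $\widetilde{\operatorname{Ric}}=cI$.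
   Context: A metric reductive decomposition $(\mathfrak g=\mathfrak k\oplus\mathfrak p,\langle\cdot,\cdot\rangle)$ of an almost-effective homogeneous space $(G/K,g)$ consists of an $\operatorname{Ad}(K)$-invariant complement $\mathfrak p\equiv T_{eK}G/K$ of $\mathfrak k$ in $\mathfrak g$ and an $\operatorname{Ad}(K)$-invariant inner product on $\mathfrak g$ with $\langle\mathfrak k,\mathfrak p\rangle=0$ and $\langle\cdot,\cdot\rangle|_{\mathfrak p}=g(eK)$. (At the Lie algebra level: $\mathfrak k$ a subalgebra, $[\mathfrak k,\mathfrak p]\subset\mathfrak p$, and $\operatorname{ad}Z$ skew-symmetric for $Z\in\mathfrak k$.) $B$ is the Killing form of $\mathfrak g$. $S(A)=\frac12(A+A^t)$. $H\in\mathfrak p$ is the unique element with $\langle H,X\rangle=\operatorname{tr}\operatorname{ad}X$ for all $X\in\mathfrak g$ ($H=0$ iff $\mathfrak g$ is unimodular). The Ricci operator of a metric reductive decomposition is $\operatorname{Ric}=M-\tfrac12B_{\mathfrak p}-S(\operatorname{ad}_{\mathfrak p}H)$ on $\mathfrak p$, where $\operatorname{ad}_{\mathfrak p}H(X)=[H,X]_{\mathfrak p}$ ($\mathfrak p$-component), $\langle B_{\mathfrak p}X,Y\rangle=\operatorname{tr}(\operatorname{ad}X\operatorname{ad}Y)$, and $$\langle MX,Y\rangle=-\tfrac12\sum_{i,j}\langle[X,X_i]_{\mathfrak p},X_j\rangle\langle[Y,X_i]_{\mathfrak p},X_j\rangle+\tfrac14\sum_{i,j}\langle[X_i,X_j]_{\mathfrak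 p},X\rangle\langle[X_i,X_j]_{\mathfrak p},Y\rangle$$ for $X,Y\in\mathfrak p$ and any orthonormal basis $\{X_i\}$ of $\mathfrak p$. It is Einstein if $\operatorname{Ric}$ is a multiple of $I$, and an algebraic soliton if $\operatorname{Ric}=cI+D_{\mathfrak p}$ for some $c\in\mathbb R$ and some symmetric $D=\begin{bmatrix}0&0\\0&D_{\mathfrak p}\end{bmatrix}\in\operatorname{Der}(\mathfrak g)$. Construction. Data: (d1) $(\mathfrak n,\langle\cdot,\cdot\rangle_{\mathfrak n})$: a metric nilpotent Lie algebra with Ricci operator $\operatorname{Ric}_{\mathfrak n}=cI+D_1$ for some $c<0$, $D_1\in\operatorname{Der}(\mathfrak n)$ (a nilsoliton; $D_1$ is then always positive definite). (d2) $(\mathfrak u=\mathfrak k\oplus\mathfrak h,\langle\cdot,\cdot\rangle_{\mathfrak u})$: a metric reductive decomposition with $\mathfrak u$ a reductive Lie algebra (semisimple plus center). (d3) $\theta:\mathfrak u\to\operatorname{Der}(\mathfrak n)$: a Lie algebra homomorphism such that (c1) $\theta(Z)^t=-\theta(Z)$ for all $Z\in\mathfrak k$; (c2) $\sum[\theta(Y_i),\theta(Y_i)^t]=0$ for any orthonormal basis $\{Y_i\}$ of $\mathfrak h$; (c3) the Ricci operator of $(\mathfrak u=\mathfrak k\oplus\mathfrak h,\langle\cdot,\cdot\rangle_{\mathfrak u})$ is $\operatorname{Ric}_{\mathfrak u}=cI+C_\theta$, where $C_\theta$ is the symmetric operator with $\langle C_\theta Y,Y\rangle=\operatorname{tr}S(\theta(Y))^2$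 for all $Y\in\mathfrak h$. Then $\mathfrak g=\mathfrak u\oplus\mathfrak n$ is the semidirect product defined by $\theta$, $\mathfrak p:=\mathfrak h\oplus\mathfrak n$, and $\langle\cdot,\cdot\rangle$ on $\mathfrak g=\mathfrak k\oplus\mathfrak h\oplus\mathfrak n$ makes this decomposition orthogonal and restricts to $\langle\cdot,\cdot\rangle_{\mathfrak u}$ and $\langle\cdot,\cdot\rangle_{\mathfrak n}$. It is known that then $\operatorname{Ric}=cI+S(D_{\mathfrak p})$ with $D=-\operatorname{ad}H+\begin{bmatrix}0&&\\&0&\\&&D_1\end{bmatrix}\in\operatorname{Der}(\mathfrak g)$. *)

(* Defs.v *)
Set Warnings "-notation-overridden,-ambiguous-paths".
From HB Require Import structures.
From mathcomp Require Import all_boot all_order all_algebra.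
From mathcomp Require Import boolp classical_sets reals.

Set Implicit Arguments.
Unset Strict Implicit.
Unset Printing Implicit Defensive.

Import Order.TTheory GRing.Theory Num.Theory.
Local Open Scope ring_scope.

Section LieAlgebra.
Variables (R : realType) (V : vectType R).
Implicit Types (br : {bilinear V -> V -> V}) (D : 'End(V)) (U W : {vspace V}).

Definition lie_bracket br : Prop :=
  (forall x, br x x = 0) /\
  (forall x y z, br x (br y z) + br y (br z x) + br z (br x y) = 0).

Definition ad br (x : V) : 'End(V) := linfun (br x).

Definition trl (f : 'End(V)) : R :=
  \tr (passmx.mxof (vbasis {:V}) (vbasis {:V}) f).

Definition killing br (x y : V) : R := trl (ad br x \o ad br y)%VF.

Definition unimodular br : Prop := forall x, trl (ad br x) = 0.

Definition derivation br D : Prop :=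
  forall x y, D (br x y) = br (D x) y + br x (D y).

(* U is stable under the adjoint action of W; ideals of V are W = {:V} *)
Definition stable br W U : Prop := {in W & U, forall x y, br x y \in U}.

Definition brv br U W : {vspace V} :=
  <<[seq br x y | x <- vbasis U, y <- vbasis W]>>%VS.

(* lower central series of V *)
Definition nilpotent_lie br : Prop :=
  exists m, iter m (brv br fullv) fullv = 0%VS.

(* derived series of the subalgebra U *)
Definition solvable_lie br U : Prop :=
  exists m, iter m (fun W => brv br W W) U = 0%VS.

(* the subalgebra U has no nonzero solvable ideal *)
Definition semisimple_lie br U : Prop :=
  forall W, (W <= U)%VS -> stable br U W -> solvable_lie br W -> W = 0%VS.

Definition reductive_lie br : Prop :=
  exists S Z : {vspace V},
    [/\ stable br fullv S, semisimple_lie br S,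
        (forall x, x \in Z <-> (forall y, br x y = 0)),
        (S + Z = fullv)%VS & (S :&: Z = 0)%VS].

End LieAlgebra.

Section Metric.
Variables (R : realType) (V : vectType R) (ip : {dot V for @idfun R}).

(* A^t : the unique operator satisfying this identity *)
Definition adjoint (A : 'End(V)) : 'End(V) :=
  xget 0 [set B : 'End(V) | forall x y, ip (A x) y = ip x (B y)]%classic.

Definition symm (A : 'End(V)) : 'End(V) := 2^-1 *: (A + adjoint A).

Definition normv (x : V) : R := Num.sqrt (ip x x).

Definition onbasis (U : {vspace V}) (X : (\dim U).-tuple V) : Prop :=
  basis_of U X /\ orthonormal ip X.

Definition onb (U : {vspace V}) : (\dim U).-tuple V :=
  xget (vbasis U) [set X | onbasis X]%classic.

(* the operator T on U determined by  ip (T x) y = f x y  for x, y in U *)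
Definition form_op (U : {vspace V}) (f : V -> V -> R) (x : V) : V :=
  \sum_(e <- onb U) f x e *: e.

End Metric.

Section MetricReductive.
Variables (R : realType) (V : vectType R).
Variables (br : {bilinear V -> V -> V}) (ip : {dot V for @idfun R}).
Variables (k p : {vspace V}).

Record metric_reductive : Prop := MetricReductive {
  mr_lie : lie_bracket br;
  mr_sum : (k + p = fullv)%VS;
  mr_direct : (k :&: p = 0)%VS;
  mr_subalg : stable br k k;
  mr_stable : stable br k p;
  mr_ortho : {in k & p, forall z x, ip z x = 0};
  mr_skew : {in k, forall z x y, ip (br z x) y = - ip x (br z y)}
}.

(* the vector H : the unique element of p satisfying this identity *)
Definition mean_curv : V :=
  xget 0 [set H : V | H \in p /\
                      (forall x, ip H x = trl (ad br x))]%classic.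

Local Notation pi := (daddv_pi p k).

Definition moment_form (x y : V) : R :=
  - 2^-1 * (\sum_(a <- onb ip p) \sum_(b <- onb ip p)
              ip (pi (br x a)) b * ip (pi (br y a)) b)
  + 4^-1 * (\sum_(a <- onb ip p) \sum_(b <- onb ip p)
              ip (pi (br a b)) x * ip (pi (br a b)) y).

(* An operator of p is extended by 0 on k: since k and p are orthogonal, the
   adjoint of the extension is the extension of the adjoint. *)
Definition adp (x : V) : 'End(V) := (pi \o ad br x \o pi)%VF.

(* Only the values on p are meaningful. *)
Definition ricci (x : V) : V :=
  form_op ip p moment_form x - 2^-1 *: form_op ip p (killing br) x
  - symm ip (adp mean_curv) x.

Definition einstein_with (c : R) : Prop := {in p, forall x, ricci x = c *: x}.

Record algebraic_soliton_with (c : R) (D : 'End(V)) : Prop :=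
  AlgebraicSoliton {
    as_der : derivation br D;
    as_sym : symm ip D = D;
    as_k : {in k, forall z, D z = 0};
    as_p : {in p, forall x, D x \in p};
    as_ricci : {in p, forall x, ricci x = c *: x + D x}
  }.

End MetricReductive.

Section Product.
Variables (R : realType) (U W : vectType R).

Definition prodv (A : {vspace U}) (B : {vspace W}) : {vspace (U * W)} :=
  ((linfun (fst : U * W -> U) @^-1: A) :&:
   (linfun (snd : U * W -> W) @^-1: B))%VS.

Definition block2_fun (A : 'End(W)) (x : U * W) : U * W := (0, A x.2).

Fact block2_is_linear (A : 'End(W)) : linear (block2_fun A).
Proof.
move=> a x y; rewrite /block2_fun; congr pair => /=.
  by rewrite scaler0 addr0.
by rewrite linearP.
Qed.

HB.instance Definition _ A := GRing.isLinear.Build R (U * W)%type (U * W)%type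
  _ (block2_fun A) (block2_is_linear A).

(* the endomorphism 0 (+) A of U (+) W *)
Definition block2 (A : 'End(W)) : 'End((U * W)%type) := linfun (block2_fun A).

Variables (ip1 : {dot U for @idfun R}) (ip2 : {dot W for @idfun R}).

Definition sum_ip (x y : U * W) : R := ip1 x.1 y.1 + ip2 x.2 y.2.

Fact sum_ip_bilinear :
  bilinear_for (GRing.Scale.Law.clone _ _ ( *%R) _)
               (GRing.Scale.Law.clone _ _ (@idfun R \; *%R) _) sum_ip.
Proof.
split=> [y|x] a u v; rewrite /sum_ip /=.
  by rewrite !linearPl /= mulrDr addrACA.
by rewrite !linearPr /= mulrDr addrACA.
Qed.

HB.instance Definition _ := bilinear_isBilinear.Build R _ _ _ _ _ sum_ip
  sum_ip_bilinear.

Fact sum_ip_herm x y : sum_ip x y = (-1) ^+ false * idfun (sum_ip y x).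
Proof.
by rewrite /sum_ip /= hermC [ip2 _ _]hermC /= !expr0 !mul1r.
Qed.

HB.instance Definition _ := isHermitianSesquilinear.Build R _ _ _ sum_ip
  sum_ip_herm.

Fact dot_ge0 (T : vectType R) (ip : {dot T for @idfun R}) x : 0 <= ip x x.
Proof.
by have [->|/(neq0_dnorm_gt0 (s := ip))/ltW//] := eqVneq x 0; rewrite linear0r.
Qed.

Fact sum_ip_gt0 x : x != 0 -> 0 < sum_ip x x.
Proof.
case: x => x y; rewrite -pair_eqE /pair_eq /= negb_and /sum_ip /=.
by case/orP => /neq0_dnorm_gt0 h; [rewrite ltr_wpDr|rewrite ltr_wpDl];
   rewrite ?dot_ge0.
Qed.

HB.instance Definition _ := isDotProduct.Build R _ sum_ip sum_ip_gt0.

End Product.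

Section Semidirect.
Variables (R : realType) (U W : vectType R).
Variables (brU : {bilinear U -> U -> U}) (brW : {bilinear W -> W -> W}).
Variable theta : {linear U -> 'End(W)}.

Definition sd_bracket (x y : U * W) : U * W :=
  (brU x.1 y.1, theta x.1 y.2 - theta y.1 x.2 + brW x.2 y.2).

Fact sd_bracket_bilinear :
  bilinear_for (GRing.Scale.Law.clone _ _ *:%R _)
               (GRing.Scale.Law.clone _ _ *:%R _) sd_bracket.
Proof.
split=> [y|x] a u v; rewrite /sd_bracket; congr pair => /=.
- by rewrite linearPl.
- rewrite !linearP linearPl /= add_lfunE scale_lfunE.
  by rewrite [X in X + _ = _]addrACA [LHS]addrACA -!scalerDr.
- by rewrite linearPr.
- rewrite !linearP /= add_lfunE scale_lfunE.
  by rewrite opprD [X in X + _ = _]addrACA [LHS]addrACA -scalerN -!scalerDr.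
Qed.

HB.instance Definition _ := bilinear_isBilinear.Build R _ _ _ _ _ sd_bracket
  sd_bracket_bilinear.

End Semidirect.

(* The Euclidean abelian Lie algebra R, with unit vector 1. *)
Section Line.
Variable R : realType.

Definition line_bracket (s t : R^o) : R^o := 0.

Fact line_bracket_bilinear :
  bilinear_for (GRing.Scale.Law.clone _ _ *:%R _)
               (GRing.Scale.Law.clone _ _ *:%R _) line_bracket.
Proof. by split=> ? a u v; rewrite /= /line_bracket scaler0 addr0. Qed.

HB.instance Definition _ := bilinear_isBilinear.Build R _ _ _ _ _ line_bracket
  line_bracket_bilinear.

Definition line_ip (s t : R^o) : R := s * t.

Fact line_ip_bilinear :
  bilinear_for (GRing.Scale.Law.clone _ _ ( *%R) _)
               (GRing.Scale.Law.clone _ _ (@idfun R \; *%R) _) line_ip.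
Proof.
split=> [y|x] a u v; rewrite /line_ip /= /GRing.scale /=.
  by rewrite mulrDl mulrA.
by rewrite mulrDr mulrCA.
Qed.

HB.instance Definition _ := bilinear_isBilinear.Build R _ _ _ _ _ line_ip
  line_ip_bilinear.

Fact line_ip_herm x y : line_ip x y = (-1) ^+ false * idfun (line_ip y x).
Proof. by rewrite /line_ip /= expr0 mul1r mulrC. Qed.

HB.instance Definition _ := isHermitianSesquilinear.Build R _ _ _ line_ip
  line_ip_herm.

Fact line_ip_gt0 x : x != 0 -> 0 < line_ip x x.
Proof. by move=> x0; rewrite /line_ip -expr2 exprn_even_gt0. Qed.

HB.instance Definition _ := isDotProduct.Build R _ line_ip line_ip_gt0.

Variables (V : vectType R) (E : 'End(V)).

Definition line_act (s : R^o) : 'End(V) := s *: E.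

Fact line_act_is_linear : linear line_act.
Proof. by move=> a s t; rewrite /line_act scalerDl scalerA. Qed.

HB.instance Definition _ := GRing.isLinear.Build R R^o 'End(V) _ line_act
  line_act_is_linear.

End Line.

(* Restriction to a subspace U; for the bracket and for operators this is the
   actual restriction only when U is a subalgebra, resp. invariant, otherwise
   the values are projected to U. *)
Section Restriction.
Variables (R : realType) (V : vectType R) (U : {vspace V}).
Variables (br : {bilinear V -> V -> V}) (ip : {dot V for @idfun R}).
Local Notation T := (subvs_of U).

Definition res_bracket (x y : T) : T := vsproj U (br (vsval x) (vsval y)).

Fact res_bracket_bilinear :
  bilinear_for (GRing.Scale.Law.clone _ _ *:%R _)
               (GRing.Scale.Law.clone _ _ *:%R _) res_bracket.
Proof.
split=> [y|x] a u v; rewrite /res_bracket /=.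
  by rewrite linearPl linearP.
by rewrite linearPr linearP.
Qed.

HB.instance Definition _ := bilinear_isBilinear.Build R _ _ _ _ _ res_bracket
  res_bracket_bilinear.

Definition res_ip (x y : T) : R := ip (vsval x) (vsval y).

Fact res_ip_bilinear :
  bilinear_for (GRing.Scale.Law.clone _ _ ( *%R) _)
               (GRing.Scale.Law.clone _ _ (@idfun R \; *%R) _) res_ip.
Proof.
split=> [y|x] a u v; rewrite /res_ip /=.
  by rewrite linearPl.
by rewrite linearPr.
Qed.

HB.instance Definition _ := bilinear_isBilinear.Build R _ _ _ _ _ res_ip
  res_ip_bilinear.

Fact res_ip_herm x y : res_ip x y = (-1) ^+ false * idfun (res_ip y x).
Proof. exact: hermC. Qed.

HB.instance Definition _ := isHermitianSesquilinear.Build R _ _ _ res_ip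
  res_ip_herm.

Fact res_ip_gt0 x : x != 0 -> 0 < res_ip x x.
Proof.
by move=> x0; apply: neq0_dnorm_gt0; apply: contra_neq x0 => /= x0;
   apply: val_inj.
Qed.

HB.instance Definition _ := isDotProduct.Build R _ res_ip res_ip_gt0.

Definition res_end (A : 'End(V)) : 'End(T) :=
  linfun (vsproj U \o A \o vsval : T -> T).

(* W :&: U as a subspace of U *)
Definition res_vspace (W : {vspace V}) : {vspace T} :=
  (linfun (vsval : T -> V) @^-1: W)%VS.

End Restriction.

Arguments res_bracket {R V} U br x y.
Arguments res_ip {R V} U ip x y.

(* For H != 0 and g0 the orthogonal complement of H, the bracket on
   R H (+) g0 that agrees with br on g0 and satisfies [H, x] = E x on g0. *)
Section ReplaceAd.
Variables (R : realType) (V : vectType R).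
Variables (br : {bilinear V -> V -> V}) (ip : {dot V for @idfun R}).
Variables (H : V) (E : 'End(V)).

Definition coef_on (x : V) : R := ip x H / ip H H.
Definition perp_part (x : V) : V := x - coef_on x *: H.

Definition replace_ad (x y : V) : V :=
  br (perp_part x) (perp_part y)
  + (coef_on x *: E (perp_part y) - coef_on y *: E (perp_part x)).

Fact coef_onP a u v : coef_on (a *: u + v) = a * coef_on u + coef_on v.
Proof. by rewrite /coef_on linearPl /= mulrDl mulrA. Qed.

Fact perp_partP a u v :
  perp_part (a *: u + v) = a *: perp_part u + perp_part v.
Proof.
by rewrite /perp_part coef_onP scalerDl scalerBr -scalerA opprD addrACA.
Qed.

Fact replace_ad_bilinear :
  bilinear_for (GRing.Scale.Law.clone _ _ *:%R _)
               (GRing.Scale.Law.clone _ _ *:%R _) replace_ad.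
Proof.
have S (s t : R) (w : V) : s *: (t *: w) = t *: (s *: w).
  by rewrite !scalerA mulrC.
split=> [y|x] a u v; rewrite /replace_ad /= coef_onP perp_partP.
- rewrite linearPl linearP /= [in RHS]scalerDr [RHS]addrACA; congr (_ + _).
  by rewrite scalerDl !scalerDr scalerN -scalerA (S _ a) opprD [LHS]addrACA.
- rewrite !linearP /= [in RHS]scalerDr [RHS]addrACA; congr (_ + _).
  by rewrite scalerDl !scalerDr scalerN -(scalerA a (coef_on u)) opprD [LHS]addrACA.
Qed.

HB.instance Definition _ := bilinear_isBilinear.Build R _ _ _ _ _ replace_ad
  replace_ad_bilinear.

End ReplaceAd.

Arguments line_bracket R s t : clear implicits.
Arguments line_ip R s t : clear implicits.

Section Data.
Variable R : realType.

(* c < 0 and Ric = c I + D1 with D1 a derivation of a nilpotent Lie algebra *)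
Record nilsoliton (n : vectType R) (br : {bilinear n -> n -> n})
    (ip : {dot n for @idfun R}) (c : R) (D1 : 'End(n)) : Prop := Nilsoliton {
  ns_lie : lie_bracket br;
  ns_nil : nilpotent_lie br;
  ns_c : c < 0;
  ns_der : derivation br D1;
  ns_ricci : forall x, ricci br ip 0%VS fullv x = c *: x + D1 x
}.

Record construction_data (n u : vectType R)
    (brn : {bilinear n -> n -> n}) (ipn : {dot n for @idfun R})
    (bru : {bilinear u -> u -> u}) (ipu : {dot u for @idfun R})
    (k h : {vspace u}) (theta : {linear u -> 'End(n)})
    (c : R) (D1 : 'End(n)) : Prop := ConstructionData {
  cd_n : nilsoliton brn ipn c D1;
  cd_u : metric_reductive bru ipu k h;
  cd_red : reductive_lie bru;
  cd_der : forall y, derivation brn (theta y);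
  cd_hom : forall x y, theta (bru x y) =
             (theta x \o theta y)%VF - (theta y \o theta x)%VF;
  cd_c1 : {in k, forall z, adjoint ipn (theta z) = - theta z};
  cd_c2 : forall Y : (\dim h).-tuple u, onbasis ipu Y ->
            \sum_(y <- Y) ((theta y \o adjoint ipn (theta y))%VF
                           - (adjoint ipn (theta y) \o theta y)%VF) = 0;
  cd_c3 : exists Ctheta : 'End(u),
    [/\ {in h, forall y, Ctheta y \in h},
        {in h &, forall x y, ipu (Ctheta x) y = ipu x (Ctheta y)},
        {in h, forall y, ipu (Ctheta y) y =
                 trl (symm ipn (theta y) \o symm ipn (theta y))%VF} &
        {in h, forall y, ricci bru ipu k h y = c *: y + Ctheta y}]
}.

End Data.

(* Main.v *)
Require Import Defs.
Set Warnings "-notation-overridden,-ambiguous-paths".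
From HB Require Import structures.
From mathcomp Require Import all_boot all_order all_algebra.
From mathcomp Require Import boolp classical_sets reals.
From mathcomp Require Import ring lra.

Set Implicit Arguments.
Unset Strict Implicit.
Unset Printing Implicit Defensive.

Import Order.TTheory GRing.Theory Num.Theory.
Local Open Scope ring_scope.

(** Let D0 be D1 extended by 0 to g. The moment map identity
    tr(M [E, E^t]) = |E^t . mu|^2 / 4, valid for a derivation E of a nilpotent
    Lie algebra with bracket mu, turns condition (c2) into: every theta(y)^t is
    a derivation of n. Hence theta(y) commutes with D1, so that D0, and with it
    S(ad H) = D0 - D, is a derivation of g. Both kill H, whence S(ad H) commutes
    with ad H and ad H is normal. Comparing the Ricci operators of u and g on h
    shows moreover that u is unimodular, so that tr(D0 ad x) vanishes for x
    orthogonal to H.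
    The three claims then follow from one computation: if a metric reductive
    decomposition of a unimodular algebra is extended by a direction A acting
    by a normal operator F that kills k, then M and the Killing form do not
    change, and only the mean curvature term -(tr F / |A|^2) S(F) is added to
    Ric. It is used for g_0 in g, for g_0 in the modified algebra, and for g in
    R A + g. *)

(** The soliton equation only makes D0 - S(ad H) a derivation, while the Jacobi identity of the new
    brackets asks that D0 itself be one. This is where (c2) enters: a derivation E of n commutes
    with D1 as soon as E^t is a derivation too. Normality of F is what makes M blind to the added
    direction: A enters M only through -F^t F / 2 and F F^t / 2, both divided by |A|^2. The constant
    alpha is forced. With F = alpha D0, the added term -(tr F / |A|^2) F equals -D0 exactly when
    alpha^2 tr D0 = |A|^2. Then Ric(A, A) = -tr F^2 = c |A|^2 follows from tr D1^2 = -c tr D1, an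
    instance of tr(Ric_n E) = 0 for derivations E of n. Dividing by tr D0 is legitimate because tr
    D1 > 0 when n is not 0. *)

Section InnerProduct.
Variables (R : realType) (V : vectType R) (ip : {dot V for @idfun R}).
Implicit Types (U : {vspace V}) (x y z : V) (A B : 'End(V)).

Lemma ipC x y : ip x y = ip y x.
Proof. by rewrite hermC expr0 mul1r. Qed.

Lemma ip0l y : ip 0 y = 0. Proof. exact: linear0l. Qed.
Lemma ip0r x : ip x 0 = 0. Proof. by rewrite ipC ip0l. Qed.

Lemma ipDl x y z : ip (x + y) z = ip x z + ip y z.
Proof. exact: linearDl. Qed.

Lemma ipDr x y z : ip x (y + z) = ip x y + ip x z.
Proof. by rewrite !(ipC x) ipDl. Qed.

Lemma ipNl x y : ip (- x) y = - ip x y. Proof. exact: linearNl. Qed.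
Lemma ipNr x y : ip x (- y) = - ip x y.
Proof. by rewrite !(ipC x) ipNl. Qed.

Lemma ipBl x y z : ip (x - y) z = ip x z - ip y z.
Proof. exact: linearBl. Qed.

Lemma ipBr x y z : ip x (y - z) = ip x y - ip x z.
Proof. by rewrite !(ipC x) ipBl. Qed.

Lemma ipZl a x y : ip (a *: x) y = a * ip x y.
Proof. exact: linearZl_LR. Qed.

Lemma ipZr a x y : ip x (a *: y) = a * ip x y.
Proof. by rewrite !(ipC x) ipZl. Qed.

Lemma ip_suml I (s : seq I) (e : I -> V) y :
  ip (\sum_(i <- s) e i) y = \sum_(i <- s) ip (e i) y.
Proof. exact: linear_sumlz. Qed.

Lemma ip_sumr I (s : seq I) (e : I -> V) x :
  ip x (\sum_(i <- s) e i) = \sum_(i <- s) ip x (e i).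
Proof. by rewrite ipC ip_suml; apply: eq_bigr => i _; rewrite ipC. Qed.

Lemma ip_eq0 x : (ip x x == 0) = (x == 0).
Proof.
apply/eqP/eqP => [|->]; last by rewrite ip0l.
by apply: contra_eq => /(neq0_dnorm_gt0 (s := ip)) /gt_eqF ->.
Qed.

Lemma ip_ge0 x : 0 <= ip x x. Proof. exact: dot_ge0. Qed.

Lemma ip_inj_in U x y : x \in U -> y \in U ->
  (forall z, z \in U -> ip x z = ip y z) -> x = y.
Proof.
move=> xU yU h; apply/eqP; rewrite -subr_eq0 -ip_eq0 ipBl h ?subrr //.
exact: rpredB.
Qed.

Lemma ip_inj x y : (forall z, ip x z = ip y z) -> x = y.
Proof. by move=> h; apply: (@ip_inj_in fullv); rewrite ?memvf. Qed.

Lemma mem_perp x y : (x \in orthov ip <[y]>%VS) = (ip x y == 0).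
Proof. exact: mem_orthov1. Qed.

(** Gram-Schmidt by induction on the dimension: a normalized vector of [U] is put before an
    orthonormal basis of its complement in [U]. Consequently the default value in the choice of
    [onb] is never taken. *)
Lemma onbasis_exists U : exists X, onbasis ip (U := U) X.
Proof.
suff [X [bX oX]] : exists X : seq V, basis_of U X /\ orthonormal ip X.
  have sX : size X == \dim U.
    by case/andP: bX => /eqP <- fX; rewrite eq_sym.
  by exists (Tuple sX).
have [m] := ubnP (\dim U); elim: m U => // m IHm U; rewrite ltnS => leU.
have [->|U0] := eqVneq U 0%VS.
  by exists [::]; rewrite /basis_of span_nil eqxx nil_free.
have w0 : ip (vpick U) (vpick U) != 0 by rewrite ip_eq0 vpick0.
have wgt0 : 0 < ip (vpick U) (vpick U) by rewrite lt_def w0 ip_ge0.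
pose u := (Num.sqrt (ip (vpick U) (vpick U)))^-1 *: vpick U.
have uU : u \in U by rewrite memvZ ?memv_pick.
have u1 : ip u u = 1.
  rewrite ipZl ipZr mulrA -expr2 exprVn sqr_sqrtr ?ip_ge0 //.
  by rewrite mulVf.
have uNo : u \notin orthov ip U.
  apply/negP => /mem_orthovP /(_ u uU) uu0; have : ip u u = 0 by exact: uu0.
  by rewrite u1 => /eqP; rewrite oner_eq0.
have dU : \dim (U :&: orthov ip <[u]>) = (\dim U).-1 by rewrite -(eq_dim_orthov1 uNo).
have Ugt0 : (0 < \dim U)%N by rewrite lt0n dimv_eq0.
have [|X [bX oX]] := IHm (U :&: orthov ip <[u]>)%VS.
  by rewrite dU; apply: leq_trans leU; rewrite prednK.
have Xu v : v \in X -> ip u v = 0.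
  move=> vX; have /(_ v vX) := basis_mem bX.
  by rewrite memv_cap mem_perp => /andP[_ /eqP]; rewrite ipC.
exists (u :: X); split; last first.
  move: oX => /andP[oX1 oX2]; apply/andP; split; apply/andP; split=> //=.
    exact/eqP.
  by rewrite andbT; apply/allP => v vX; apply/eqP/Xu.
have sX : size X = (\dim U).-1.
  by case/andP: bX => /eqP sX; rewrite /free sX dU => /eqP.
have spX : <<X>>%VS = (U :&: orthov ip <[u]>)%VS by case/andP: bX => /eqP.
rewrite basisEdim /= sX prednK // leqnn andbT.
apply/subvP => v vU; rewrite span_cons -[v](subrK (ip v u *: u)) addrC.
apply: memv_add; first by rewrite memvZ ?memv_line.
rewrite spX memv_cap.
apply/andP; split; first by apply: rpredB => //; apply: memvZ.
by rewrite mem_perp ipBl ipZl u1 mulr1 subrr.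
Qed.

Lemma onbP U : onbasis ip (onb ip U).
Proof. exact: (xgetPex _ (onbasis_exists U)). Qed.

Lemma onb_mem U a : a \in onb ip U -> a \in U.
Proof. by have [/basis_mem bX _] := onbP U; apply: bX. Qed.

Lemma orthonormal_expand (X : seq V) v : orthonormal ip X -> v \in <<X>>%VS ->
  v = \sum_(a <- X) ip v a *: a.
Proof.
elim: X v => [|a X IHX] v.
  by rewrite span_nil memv0 big_nil => _ /eqP.
case/andP => /andP[/eqP a1 n1] /andP[/andP[aX _] oX].
have aX0 b : b \in X -> ip a b = 0 by move=> /(allP aX)/eqP.
have {}oX : orthonormal ip X by apply/andP.
have aS w : w \in <<X>>%VS -> ip w a = 0.
  move=> /(IHX w oX) ->.
  by rewrite ip_suml big_seq big1 // => b bX; rewrite ipZl [ip b a]ipC aX0 ?mulr0.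
rewrite span_cons => /memv_addP[_ /vlineP[s ->] [w wX ->]].
rewrite big_cons ipDl ipZl a1 mulr1 aS // addr0; congr (_ + _).
rewrite {1}(IHX w) //.
apply: eq_big_seq => b bX; congr (_ *: _).
by rewrite ipDl ipZl aX0 // mulr0 add0r.
Qed.

Lemma onbasis_expand U (X : (\dim U).-tuple V) v : onbasis ip X -> v \in U ->
  v = \sum_(a <- X) ip v a *: a.
Proof.
by move=> [bX oX] vU; apply: orthonormal_expand; rewrite ?(span_basis bX).
Qed.

Lemma onb_expand U v : v \in U -> v = \sum_(a <- onb ip U) ip v a *: a.
Proof. exact: (onbasis_expand (onbP U)). Qed.

Lemma onb_parseval U x y : x \in U ->
  \sum_(a <- onb ip U) ip x a * ip y a = ip x y.
Proof.
move=> xU; rewrite [in RHS](onb_expand xU) ip_suml.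
by apply: eq_bigr => a _; rewrite ipZl [ip y a]ipC.
Qed.

(** [g] is a bare function with a linearity proof, so that sums of products of brackets written in
    place can be used without packing each one as a linear map. *)
Lemma scalar_comb (g : V -> R) I (s : seq I) (w : I -> R) (e : I -> V) :
  scalar g -> g (\sum_(i <- s) w i *: e i) = \sum_(i <- s) w i * g (e i).
Proof.
move=> lg; have g0 : g 0 = 0.
  by have := lg (-1) 0 0; rewrite scaler0 addr0 mulN1r addNr.
elim: s => [|i s IHs]; first by rewrite !big_nil.
by rewrite !big_cons lg IHs.
Qed.

(* The weights allow a frame with vectors that are not normalized, or zero. *)
Lemma sum_onb_frame U (f : V -> V -> R) I (s : seq I) (w : I -> R)
    (e : I -> V) :
  (forall y, scalar (f^~ y)) -> (forall x, scalar (f x)) ->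
  (forall i, e i \in U) ->
  (forall v, v \in U -> v = \sum_(i <- s) (w i * ip v (e i)) *: e i) ->
  \sum_(a <- onb ip U) f a a = \sum_(i <- s) w i * f (e i) (e i).
Proof.
move=> fl fr eU ve.
transitivity (\sum_(a <- onb ip U) \sum_(i <- s) w i * ip a (e i) * f (e i) a).
  apply: eq_big_seq => a /onb_mem aU; rewrite {1}(ve a aU).
  exact: (scalar_comb _ _ _ (fl a)).
rewrite exchange_big; apply: eq_bigr => i _ /=.
have -> : f (e i) (e i) = \sum_(a <- onb ip U) ip (e i) a * f (e i) a.
  by rewrite {2}(onb_expand (eU i)); apply: scalar_comb (fr _).
rewrite mulr_sumr; apply: eq_bigr => a _.
by rewrite mulrA [ip a _]ipC.
Qed.

End InnerProduct.

(** * Traces and adjoints *)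

Section Trace.
Variables (R : realType) (V : vectType R).

Lemma trl_coord (T : 'End(V)) :
  trl T = \sum_i coord (vbasis {:V}) i (T (vbasis {:V})`_i).
Proof.
rewrite /trl /mxtrace; apply: eq_bigr => i _.
by rewrite !mxE /= passmx.vecof_delta.
Qed.

(** The vectors [e i] need not be a basis: any resolution of the identity as a sum of rank one maps
    computes the trace. This allows a zero vector in the family and families assembled from several
    spaces. *)
Lemma trl_frame (T : 'End(V)) I (s : seq I) (phi : I -> V -> R) (e : I -> V) :
  (forall i, scalar (phi i)) ->
  (forall v, v = \sum_(i <- s) phi i v *: e i) ->
  trl T = \sum_(i <- s) phi i (T (e i)).
Proof.
move=> lphi ve; rewrite trl_coord.
transitivity (\sum_(i < \dim {:V}) \sum_(j <- s) phi j (vbasis {:V})`_i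
                * coord (vbasis {:V}) i (T (e j))).
  apply: eq_bigr => i _; rewrite {1}(ve (vbasis {:V})`_i) !linear_sum.
  by apply: eq_bigr => j _; rewrite !linearZ.
rewrite exchange_big; apply: eq_bigr => j _ /=.
rewrite [X in phi j X](coord_vbasis (memvf (T (e j)))) -big_enum.
by rewrite scalar_comb // -big_enum; apply: eq_bigr => i _; rewrite mulrC.
Qed.

Lemma trlD (S T : 'End(V)) : trl (S + T) = trl S + trl T.
Proof.
rewrite !trl_coord -big_split; apply: eq_bigr => i _.
by rewrite add_lfunE linearD.
Qed.

Lemma trlZ a (T : 'End(V)) : trl (a *: T) = a * trl T.
Proof.
rewrite !trl_coord mulr_sumr; apply: eq_bigr => i _.
by rewrite scale_lfunE linearZ.
Qed.

Lemma trl0 : trl (0 : 'End(V)) = 0.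
Proof. by rewrite -(scale0r (0 : 'End(V))) trlZ mul0r. Qed.

Lemma trlN (T : 'End(V)) : trl (- T) = - trl T.
Proof. by rewrite -scaleN1r trlZ mulN1r. Qed.

(** The two maps may join different spaces, which is how traces pass between [V] and a subspace in
    [trl_restrict]. *)
Lemma trlC (W : vectType R) (S : 'Hom(W, V)) (T : 'Hom(V, W)) :
  trl (S \o T)%VF = trl (T \o S)%VF.
Proof.
rewrite /trl (@passmx.mxof_comp _ _ _ _ _ (vbasis {:W})) ?vbasisP //.
by rewrite (@passmx.mxof_comp _ _ _ _ _ (vbasis {:V})) ?vbasisP // mxtrace_mulC.
Qed.

Variable ip : {dot V for @idfun R}.

Lemma trl_onb (T : 'End(V)) : trl T = \sum_(a <- onb ip fullv) ip (T a) a.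
Proof.
apply: (@trl_frame T _ (onb ip fullv) (fun a v => ip v a) id) => [a b u v|v].
  by rewrite ipDl ipZl.
exact: onb_expand (memvf v).
Qed.

End Trace.

Lemma lfun_exists (R : realType) (V W : vectType R) (f : V -> W) :
  linear f -> exists B : 'Hom(V, W), forall x, B x = f x.
Proof.
move=> lf; pose F : {linear V -> W} := HB.pack f (GRing.isLinear.Build _ _ _ _ f lf).
by exists (linfun F) => x; rewrite lfunE.
Qed.

Lemma compA (R : realType) (V : vectType R) (S T U : 'End(V)) :
  ((S \o T) \o U = S \o (T \o U))%VF.
Proof. by apply/lfunP => x; rewrite !comp_lfunE. Qed.

Section Scalar.
Variables (R : realType) (V : vectType R).

Lemma scalar_sum I (s : seq I) (g : I -> V -> R) :
  (forall i, scalar (g i)) -> scalar (fun x => \sum_(i <- s) g i x).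
Proof.
move=> lg a x y; rewrite mulr_sumr -big_split.
by apply: eq_bigr => i _; apply: lg.
Qed.

Lemma scalarM c (g : V -> R) : scalar g -> scalar (fun x => c * g x).
Proof. by move=> lg a x y; rewrite lg mulrDr mulrCA. Qed.

Lemma scalarMr c (g : V -> R) : scalar g -> scalar (fun x => g x * c).
Proof. by move=> lg a x y; rewrite lg mulrDl mulrA. Qed.

Lemma scalarD (f g : V -> R) :
  scalar f -> scalar g -> scalar (fun x => f x + g x).
Proof. by move=> lf lg a x y; rewrite lf lg mulrDr addrACA. Qed.

Variable ip : {dot V for @idfun R}.

Lemma scalar_ipl (U : vectType R) (T : {linear U -> V}) y :
  scalar (fun x => ip (T x) y).
Proof. by move=> a u v; rewrite linearP ipDl ipZl. Qed.

Lemma scalar_ip x : scalar (ip x).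
Proof. by move=> a u v; rewrite ipDr ipZr. Qed.

Lemma scalar_ip' y : scalar (ip^~ y).
Proof. by move=> a u v; rewrite ipDl ipZl. Qed.

End Scalar.

Section Adjoint.
Variables (R : realType) (V : vectType R) (ip : {dot V for @idfun R}).
Implicit Types (x y : V) (A B : 'End(V)).

Lemma adjointP A x y : ip (A x) y = ip x (adjoint ip A y).
Proof.
suff [B AB] : exists B : 'End(V), forall x y, ip (A x) y = ip x (B y).
  have := xgetPex 0 (P := [set B : 'End(V) |
    forall x y, ip (A x) y = ip x (B y)]%classic).
  by apply; exists B.
have [|B BE] := @lfun_exists R V V
    (fun y => \sum_(a <- onb ip fullv) ip y (A a) *: a).
  move=> a u v; rewrite scaler_sumr -big_split; apply: eq_bigr => b _ /=.
  by rewrite ipDl ipZl scalerDl scalerA.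
exists B => {}x {}y; rewrite BE ip_sumr [in LHS](onb_expand ip (memvf x)).
rewrite linear_sum ip_suml; apply: eq_bigr => a _.
by rewrite linearZ ipZl ipZr mulrC [ip y _]ipC.
Qed.

Lemma adjointPr A x y : ip (adjoint ip A x) y = ip x (A y).
Proof. by rewrite ipC -adjointP ipC. Qed.

Lemma adjoint_eq A B : (forall x y, ip (A x) y = ip x (B y)) ->
  adjoint ip A = B.
Proof.
move=> AB; apply/lfunP => x; apply: (@ip_inj _ _ ip) => y.
by rewrite adjointPr ipC AB ipC.
Qed.

Lemma symmE A x : symm ip A x = 2^-1 *: (A x + adjoint ip A x).
Proof. by rewrite /symm scale_lfunE add_lfunE. Qed.

Lemma ip_symm A x y : ip (symm ip A x) y = 2^-1 * (ip (A x) y + ip x (A y)).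
Proof. by rewrite symmE ipZl ipDl adjointPr. Qed.

Lemma symm_sym A x y : ip (symm ip A x) y = ip x (symm ip A y).
Proof. by rewrite [RHS]ipC !ip_symm addrC [ip y _]ipC [ip (A y) _]ipC. Qed.

Lemma symmP A : symm ip A = A <-> forall x y, ip (A x) y = ip x (A y).
Proof.
split=> [<- x y|AA]; first exact: symm_sym.
rewrite /symm (adjoint_eq AA) -mulr2n -scaler_nat scalerA mulVf ?scale1r //.
by rewrite pnatr_eq0.
Qed.

Lemma trl_adjoint A : trl (adjoint ip A) = trl A.
Proof.
by rewrite !(trl_onb ip); apply: eq_bigr => a _; rewrite adjointPr ipC.
Qed.

Lemma trl_sqr_ge0 A : 0 <= trl (adjoint ip A \o A)%VF.
Proof.
rewrite (trl_onb ip); apply: sumr_ge0 => a _.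
by rewrite comp_lfunE adjointPr ip_ge0.
Qed.

Lemma trl_sqr_eq0 A : trl (adjoint ip A \o A)%VF = 0 -> A = 0.
Proof.
rewrite (trl_onb ip) => /eqP; rewrite psumr_eq0; last first.
  by move=> a _; rewrite comp_lfunE adjointPr ip_ge0.
move=> /allP h; apply/lfunP => x; rewrite zero_lfunE.
rewrite (onb_expand ip (memvf x)) linear_sum big_seq big1 // => a aX.
have /implyP/(_ isT) := h a aX.
by rewrite comp_lfunE adjointPr ip_eq0 linearZ /= => /eqP ->; rewrite scaler0.
Qed.

(** Testing against B = A^t gives the square norm of [A]. *)
Lemma trl_eq0_all A : (forall B, trl (A \o B)%VF = 0) -> A = 0.
Proof. by move=> h; apply: trl_sqr_eq0; rewrite trlC h. Qed.

End Adjoint.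

Section Lie.
Variables (R : realType) (V : vectType R) (br : {bilinear V -> V -> V}).
Implicit Types (x y z : V) (a : R).

Lemma brDl x y z : br (x + y) z = br x z + br y z.
Proof. exact: linearDl. Qed.

Lemma brDr x y z : br x (y + z) = br x y + br x z.
Proof. exact: linearDr. Qed.

Lemma brZl a x y : br (a *: x) y = a *: br x y.
Proof. exact: linearZl_LR. Qed.

Lemma brZr a x y : br x (a *: y) = a *: br x y.
Proof. exact: linearZr_LR. Qed.

Lemma brNl x y : br (- x) y = - br x y. Proof. exact: linearNl. Qed.

Lemma brNr x y : br x (- y) = - br x y. Proof. exact: linearNr. Qed.

Lemma br0l y : br 0 y = 0. Proof. exact: linear0l. Qed.

Lemma br0r x : br x 0 = 0. Proof. exact: linear0r. Qed.

Lemma adE x y : ad br x y = br x y. Proof. exact: lfunE. Qed.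

Hypothesis Lbr : lie_bracket br.

Lemma brxx x : br x x = 0. Proof. by have [-> _] := Lbr. Qed.

Lemma brC x y : br x y = - br y x.
Proof.
apply/eqP; rewrite -addr_eq0; apply/eqP.
by have := brxx (x + y); rewrite linearDl !linearDr !brxx add0r addr0.
Qed.

Lemma jacobi x y z : br x (br y z) = br (br x y) z + br y (br x z).
Proof.
have [_ /(_ x y z)] := Lbr.
rewrite [br z x]brC [br z (br x y)]brC linearNr => /eqP.
by rewrite subr_eq0 => /eqP <-; rewrite addrNK.
Qed.

End Lie.

(** * The Ricci operator as a bilinear form *)

Section RicciForm.
Variables (R : realType) (V : vectType R).
Variables (br : {bilinear V -> V -> V}) (ip : {dot V for @idfun R}).
Variables (k p : {vspace V}).

(** [moment_form] without its projections: for x, y in p every bracket is paired with a vector of p,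
    and k is orthogonal to p. *)
Definition mform (x y : V) : R :=
  - 2^-1 * (\sum_(a <- onb ip p) \sum_(b <- onb ip p)
              ip (br x a) b * ip (br y a) b)
  + 4^-1 * (\sum_(a <- onb ip p) \sum_(b <- onb ip p)
              ip (br a b) x * ip (br a b) y).

Local Notation H := (mean_curv br ip p).

Definition ricform (x y : V) : R :=
  mform x y - 2^-1 * killing br x y
  - 2^-1 * (ip (br H x) y + ip x (br H y)).

Hypothesis mr : metric_reductive br ip k p.

Let Lbr := mr_lie mr.

Lemma mr_decomp v : v = daddv_pi p k v + daddv_pi k p v.
Proof.
by rewrite daddv_pi_add // 1?capvC ?(mr_direct mr) // addvC (mr_sum mr) memvf.
Qed.

Lemma mr_ortho' z x : z \in k -> x \in p -> ip x z = 0.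
Proof. by move=> zk xp; rewrite ipC (mr_ortho mr). Qed.

Lemma ip_pi v w : w \in p -> ip (daddv_pi p k v) w = ip v w.
Proof.
by move=> wp; rewrite [in RHS](mr_decomp v) ipDl (mr_ortho mr (memv_pi k p v) wp) addr0.
Qed.

Lemma mem_pP x : (x \in p) <-> (forall z, z \in k -> ip x z = 0).
Proof.
split=> [xp z zk|h]; first exact: mr_ortho'.
suff -> : x = daddv_pi p k x by apply: memv_pi.
apply/eqP; rewrite eq_sym -subr_eq0; set d := _ - _.
have dk : d \in k.
  by rewrite /d {2}(mr_decomp x) opprD addNKr rpredN memv_pi.
rewrite -(ip_eq0 ip) {1}/d ipBl h // subr0 mr_ortho' //.
exact: memv_pi.
Qed.

Lemma mr_skew_ad z : z \in k -> trl (ad br z) = 0.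
Proof.
move=> zk; have : trl (adjoint ip (ad br z)) = - trl (ad br z).
  rewrite -trlN; congr trl; apply: adjoint_eq => x y.
  by rewrite opp_lfunE !adE (mr_skew mr) // ipNr.
by rewrite trl_adjoint => ?; lra.
Qed.

(** On k the functional tr ad vanishes, since ad z is skew there; hence the vector of p that
    represents it on p represents it on all of g. *)
Lemma mean_curvP :
  H \in p /\ (forall x, ip H x = trl (ad br x)).
Proof.
suff [h [hp hE]] : exists h, h \in p /\ (forall x, ip h x = trl (ad br x)).
  have := xgetPex 0 (P := [set H : V | H \in p /\
                      (forall x, ip H x = trl (ad br x))]%classic).
  by apply; exists h.
pose t x := trl (ad br x).
have lt : scalar t.
  move=> a x y; rewrite /t -trlZ -trlD; congr trl; apply/lfunP => v.
  by rewrite add_lfunE scale_lfunE !adE linearPl.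
exists (\sum_(a <- onb ip p) t a *: a); split.
  by rewrite big_seq rpred_sum // => a /onb_mem ap; rewrite memvZ.
move=> x; rewrite ip_suml.
transitivity (t (daddv_pi p k x)).
  rewrite (onb_expand ip (memv_pi p k x)) (scalar_comb _ _ _ lt).
  apply: eq_big_seq => a /onb_mem ap.
  by rewrite ipZl ip_pi // mulrC [ip x a]ipC.
rewrite -/(t x) {2}(mr_decomp x) -[X in t (X + _)]scale1r lt mul1r.
by rewrite [t (daddv_pi k p x)]mr_skew_ad ?addr0 // memv_pi.
Qed.

Lemma mean_curv_eq h :
  h \in p -> (forall x, x \in p -> ip h x = trl (ad br x)) -> H = h.
Proof.
have [Hp HE] := mean_curvP => hp hE; apply: (ip_inj_in (ip := ip) Hp hp) => x xp.
by rewrite HE hE.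
Qed.

(** ad [x, y] is a commutator and has trace 0. Thus the complement of H contains every bracket and
    is an ideal. *)
Lemma mean_curv_bracket x y : ip H (br x y) = 0.
Proof.
have [_ ->] := mean_curvP.
have -> : ad br (br x y) = (ad br x \o ad br y)%VF - (ad br y \o ad br x)%VF.
  apply/lfunP => v; rewrite add_lfunE opp_lfunE !comp_lfunE !adE.
  by rewrite [br x (br y v)](jacobi Lbr) addrK.
by rewrite trlD trlN trlC subrr.
Qed.

(** Skewness of ad z turns <[z, H], x> into -<H, [z, x]>, and H is orthogonal to brackets. *)
Lemma ad_mean_curv_k z : z \in k -> br H z = 0.
Proof.
move=> zk; apply: (@ip_inj _ _ ip) => x; rewrite ip0l (brC Lbr) ipNl.
by rewrite (mr_skew mr) // mean_curv_bracket !oppr0.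
Qed.

(* tr ad(T x) = tr [T, ad x] = 0 for every derivation T. *)
Lemma derivation_mean_curv (T : 'End(V)) :
  derivation br T -> symm ip T = T -> T H = 0.
Proof.
move=> derT /symmP symT; have [_ HE] := mean_curvP.
apply: (@ip_inj _ _ ip) => x; rewrite ip0l symT HE.
have -> : ad br (T x) = (T \o ad br x)%VF - (ad br x \o T)%VF.
  apply/lfunP => v; rewrite add_lfunE opp_lfunE !comp_lfunE !adE.
  by rewrite derT addrK.
by rewrite trlD trlN trlC subrr.
Qed.

Lemma form_opP (f : V -> V -> R) x y : scalar (f x) -> y \in p ->
  ip (form_op ip p f x) y = f x y.
Proof.
move=> lf yp; rewrite /form_op ip_suml [in RHS](onb_expand ip yp).
rewrite (scalar_comb _ _ _ lf); apply: eq_bigr => a _.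
by rewrite ipZl mulrC [ip y a]ipC.
Qed.

Lemma form_op_mem (f : V -> V -> R) x : form_op ip p f x \in p.
Proof. by rewrite /form_op big_seq rpred_sum // => a /onb_mem ap; rewrite memvZ. Qed.

Lemma killing_scalar x : scalar (killing br x).
Proof.
move=> a u v; rewrite /killing -trlZ -trlD; congr trl; apply/lfunP => w.
by rewrite add_lfunE scale_lfunE !comp_lfunE !adE linearPl linearP.
Qed.

Lemma moment_form_scalar x : scalar (moment_form br ip k p x).
Proof.
apply: scalarD; apply: scalarM; apply: scalar_sum => a; apply: scalar_sum => b;
  apply: scalarM => s y z.
  by rewrite linearPl linearP ipDl ipZl.
by rewrite ipDr ipZr.
Qed.

Lemma moment_formE x y : x \in p -> y \in p ->
  moment_form br ip k p x y = mform x y.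
Proof.
move=> xp yp; rewrite /moment_form /mform; congr (_ * _ + _ * _);
  apply: eq_bigr => a _; apply: eq_big_seq => b /onb_mem bp; by rewrite !ip_pi.
Qed.

Lemma ip_adp h x y : x \in p -> y \in p -> ip (adp br k p h x) y = ip (br h x) y.
Proof.
move=> xp yp; rewrite /adp !comp_lfunE adE ip_pi //.
by rewrite daddv_pi_id // capvC (mr_direct mr).
Qed.

Lemma symm_adp_mem h x : symm ip (adp br k p h) x \in p.
Proof.
apply/mem_pP => z zk; rewrite ip_symm.
have -> : ip (adp br k p h x) z = 0.
  by rewrite mr_ortho' // !comp_lfunE memv_pi.
suff -> : adp br k p h z = 0 by rewrite ip0r addr0 mulr0.
have z0 : daddv_pi p k z = 0.
  apply/eqP; rewrite -(ip_eq0 ip) ip_pi ?memv_pi // (mr_ortho mr) //.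
  exact: memv_pi.
by rewrite !comp_lfunE z0 !linear0.
Qed.

Lemma ricci_mem x : ricci br ip k p x \in p.
Proof.
by rewrite rpredB ?symm_adp_mem // rpredB ?memvZ ?form_op_mem.
Qed.

Lemma ip_ricci x y : x \in p -> y \in p ->
  ip (ricci br ip k p x) y = ricform x y.
Proof.
move=> xp yp; rewrite /ricci /ricform !ipBl ipZl ip_symm.
rewrite (form_opP (moment_form_scalar x)) // (form_opP (killing_scalar x)) //.
by rewrite moment_formE // [ip x (adp _ _ _ _ _)]ipC !ip_adp // [ip (br _ y) _]ipC.
Qed.

Lemma ricci_eqP x w : x \in p -> w \in p ->
  ricci br ip k p x = w <-> forall y, y \in p -> ricform x y = ip w y.
Proof.
move=> xp wp; split=> [<- y yp|h]; first by rewrite ip_ricci.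
by apply: (ip_inj_in (ip := ip) (ricci_mem x) wp) => y yp; rewrite ip_ricci ?h.
Qed.

Lemma ricform_scalar x : scalar (ricform x).
Proof.
have lm : scalar (mform x).
  apply: scalarD; apply: scalarM; apply: scalar_sum => a; apply: scalar_sum => b;
    apply: scalarM => s u v.
    by rewrite linearPl ipDl ipZl.
  by rewrite ipDr ipZr.
move=> a u v; rewrite /ricform lm killing_scalar ipDr ipZr [br _ (_ + _)]linearPr /= ipDr ipZr.
by ring.
Qed.

Lemma ricformC x y : ricform x y = ricform y x.
Proof.
rewrite /ricform /mform /killing trlC [ip (br H x) y]ipC.
rewrite [ip x _]ipC [ip y _ + _]addrC.
congr (_ * _ + _ * _ - _ - _); apply: eq_bigr => a _; apply: eq_bigr => b _;
  exact: mulrC.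
Qed.

Lemma sum_onb_p (f : V -> V -> R) :
  (forall y, scalar (f^~ y)) -> (forall x, scalar (f x)) ->
  (forall z, z \in k -> f z z = 0) ->
  \sum_(a <- onb ip p) f a a = \sum_(a <- onb ip fullv) f a a.
Proof.
move=> fl fr fk.
rewrite [RHS](@sum_onb_frame _ _ _ _ _ _ (onb ip p ++ onb ip k) (fun=> 1) id) //.
- rewrite big_cat /= [X in _ = _ + X]big_seq [X in _ = _ + X]big1 ?addr0.
    by apply: eq_bigr => a _; rewrite mul1r.
  by move=> a /onb_mem ak; rewrite fk ?mulr0.
- by move=> a; rewrite memvf.
move=> v _; rewrite big_cat /=.
have [vp vk] := (memv_pi p k v, memv_pi k p v).
rewrite [LHS](mr_decomp v) [in LHS](onb_expand ip vp) [X in _ + X](onb_expand ip vk).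
congr (_ + _); apply: eq_big_seq => a /onb_mem am; rewrite mul1r.
  by rewrite ip_pi.
by rewrite [in RHS](mr_decomp v) ipDl (mr_ortho' am (memv_pi p k v)) add0r.
Qed.

Lemma trl_onb_p (T : 'End(V)) : (forall x, T x \in p) ->
  trl T = \sum_(a <- onb ip p) ip (T a) a.
Proof.
move=> Tp; rewrite (trl_onb ip) (@sum_onb_p (fun x y => ip (T x) y)) //.
- by move=> y; apply: scalar_ipl.
- by move=> x; apply: scalar_ip.
by move=> z zk; rewrite mr_ortho'.
Qed.

End RicciForm.

(** * Extensions by one orthogonal direction *)

Section CodimensionOne.
Variables (R : realType) (W V : vectType R).
Variables (brW : {bilinear W -> W -> W}) (ipW : {dot W for @idfun R}).
Variables (kW pW : {vspace W}).
Variables (br : {bilinear V -> V -> V}) (ip : {dot V for @idfun R}).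
Variables (k p : {vspace V}).
(** An abstract isometric embedding [i] instead of an inclusion lets the computation serve both for
    the subspace g0 and for g as a factor of a product. *)
Variables (i : {linear W -> V}) (A : V) (F : 'End(W)).
Hypothesis mrW : metric_reductive brW ipW kW pW.
Hypothesis mr : metric_reductive br ip k p.
Hypothesis i_ip : forall x y, ip (i x) (i y) = ipW x y.
Hypothesis i_br : forall x y, br (i x) (i y) = i (brW x y).
Hypothesis A_perp : forall x, ip A (i x) = 0.
Hypothesis A_p : A \in p.
(* A = 0 is allowed: the quotient is then 0. *)
Hypothesis i_A_span : forall v, exists w, v = i w + (ip v A / ip A A) *: A.
Hypothesis i_k : {in kW, forall z, i z \in k}.
Hypothesis i_p : {in pW, forall x, i x \in p}.
Hypothesis brA : forall x, br A (i x) = i (F x).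
Hypothesis uniW : unimodular brW.
Hypothesis F_normal : forall x y,
  ipW (F x) (F y) = ipW (adjoint ipW F x) (adjoint ipW F y).
Hypothesis F_k : {in kW, forall z, F z = 0}.

Local Notation Ft := (adjoint ipW F).

Let A_perp' x : ip (i x) A = 0. Proof. by rewrite ipC A_perp. Qed.

(** A normal operator and its adjoint give every vector the same norm, so they have the same kernel.
    It follows that both have their image in [pW], the complement of [kW]. *)
Let Ft_k z : z \in kW -> Ft z = 0.
Proof.
by move=> zk; apply/eqP; rewrite -(ip_eq0 ipW) -F_normal F_k // ip0l.
Qed.

Let F_p x : F x \in pW.
Proof. by apply/(mem_pP mrW) => z zk; rewrite adjointP Ft_k // ip0r. Qed.

Let Ft_p x : Ft x \in pW.
Proof. by apply/(mem_pP mrW) => z zk; rewrite adjointPr F_k // ip0r. Qed.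

Let p_decomp x : x \in p -> exists2 w, w \in pW
  & x = i w + (ip x A / ip A A) *: A.
Proof.
have [w xE] := i_A_span x => xp; exists w => //.
apply/(mem_pP mrW) => z zk; rewrite -i_ip.
have -> : ip (i w) (i z) = ip x (i z) by rewrite xE ipDl ipZl A_perp mulr0 addr0.
by rewrite (mr_ortho' mr) ?i_k.
Qed.

Let br_iA x : br (i x) A = i (- F x).
Proof. by rewrite (brC (mr_lie mr)) brA linearN. Qed.

(** The image of [i] is an ideal that contains every bracket. All diagonal entries at [A] of the
    traces below vanish for this reason. *)
Let ip_brA v w : ip (br v w) A = 0.
Proof.
have [v' ->] := i_A_span v; have [w' ->] := i_A_span w.
rewrite brDl !brDr !brZl !brZr i_br br_iA brA (brxx (mr_lie mr)).
by rewrite !ipDl !ipZl !A_perp' ip0l !mulr0 !addr0.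
Qed.

Lemma sum_onb_ext (f : V -> V -> R) :
  (forall y, scalar (f^~ y)) -> (forall x, scalar (f x)) ->
  \sum_(a <- onb ip p) f a a =
  \sum_(a <- onb ipW pW) f (i a) (i a) + (ip A A)^-1 * f A A.
Proof.
move=> fl fr.
(* [None] stands for A, which gets the weight 1/|A|^2 instead of being normalized. As 0^-1 = 0, it
   drops out when A = 0. The test [a \in pW] with default 0 keeps the frame in p at every index, as
   [sum_onb_frame] demands. *)
pose s := None :: map Some (onb ipW pW).
rewrite (@sum_onb_frame _ _ _ _ f _ s (fun o => if o is Some a then
    (a \in pW)%:R else (ip A A)^-1) (fun o => if o is Some a then
    i (if a \in pW then a else 0) else A)) //.
- rewrite big_cons big_map addrC; congr (_ + _).
  by apply: eq_big_seq => a /onb_mem ->; rewrite mul1r.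
- move=> [a|] //; case: ifP => [/i_p //|_]; by rewrite linear0 mem0v.
move=> v vp; have [x xp vE] := p_decomp vp.
rewrite big_cons big_map mulrC -[LHS]addr0 {1}vE addr0 addrC; congr (_ + _).
rewrite {1}(onb_expand ipW xp) linear_sum; apply: eq_big_seq => a /onb_mem ap.
by rewrite ap mul1r linearZ /= vE ipDl i_ip ipZl A_perp mulr0 addr0.
Qed.

Lemma trl_ext (T : 'End(V)) :
  trl T = \sum_(a <- onb ipW fullv) ip (T (i a)) (i a)
          + (ip A A)^-1 * ip (T A) A.
Proof.
pose phi o v := if o is Some a then ip v (i a) else (ip A A)^-1 * ip v A.
rewrite (@trl_frame _ _ T _ (None :: map Some (onb ipW fullv)) phi
  (fun o => if o is Some a then i a else A)).
- by rewrite big_cons big_map addrC.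
- by move=> [a|]; [apply: scalar_ip'|apply: scalarM; apply: scalar_ip'].
move=> v; have [x vE] := i_A_span v.
rewrite big_cons big_map /= mulrC -[LHS]addr0 {1}vE addr0 addrC; congr (_ + _).
rewrite {1}(onb_expand ipW (memvf x)) linear_sum; apply: eq_bigr => a _.
by rewrite linearZ /= vE ipDl i_ip ipZl A_perp mulr0 addr0.
Qed.

Let mean_curvW : mean_curv brW ipW pW = 0.
Proof.
by apply: (mean_curv_eq mrW); rewrite ?mem0v // => x _; rewrite ip0l uniW.
Qed.

(** Since W is unimodular, only the A-component of x contributes to tr ad x, through tr F. *)
Lemma mean_curv_ext : mean_curv br ip p = (trl F / ip A A) *: A.
Proof.
apply: (mean_curv_eq mr) => [|x _]; first exact: memvZ.
have [w xE] := i_A_span x.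
rewrite trl_ext adE ip_brA mulr0 addr0 ipZl.
transitivity (\sum_(a <- onb ipW fullv)
    (ipW (brW w a) a + (ip x A / ip A A) * ipW (F a) a)).
  rewrite big_split /= -mulr_sumr -trl_onb.
  under eq_bigr do rewrite -adE.
  by rewrite -trl_onb uniW add0r [ip A x]ipC; ring.
apply: eq_bigr => a _.
by rewrite adE {2}xE brDl brZl i_br brA ipDl ipZl !i_ip.
Qed.

Lemma killing_ext x y : killing br (i x) (i y) = killing brW x y.
Proof.
rewrite /killing trl_ext comp_lfunE !adE ip_brA mulr0 addr0 (trl_onb ipW).
by apply: eq_bigr => a _; rewrite !comp_lfunE !adE !i_br i_ip.
Qed.

Let f1l (x y : V) : forall c, scalar ((fun a a' => \sum_(b <- onb ip p)
  ip (br x a) b * ip (br y a') b)^~ c).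
Proof.
move=> c; apply: scalar_sum => b; apply: scalarMr => s u v.
by rewrite brDr brZr ipDl ipZl.
Qed.

Let f1r (x y : V) : forall c, scalar ((fun a a' => \sum_(b <- onb ip p)
  ip (br x a) b * ip (br y a') b) c).
Proof.
move=> c; apply: scalar_sum => b; apply: scalarM => s u v.
by rewrite brDr brZr ipDl ipZl.
Qed.

Let f2l (x y : V) : forall c, scalar ((fun a a' => \sum_(b <- onb ip p)
  ip (br a b) x * ip (br a' b) y)^~ c).
Proof.
move=> c; apply: scalar_sum => b; apply: scalarMr => s u v.
by rewrite brDl brZl ipDl ipZl.
Qed.

Let f2r (x y : V) : forall c, scalar ((fun a a' => \sum_(b <- onb ip p)
  ip (br a b) x * ip (br a' b) y) c).
Proof.
move=> c; apply: scalar_sum => b; apply: scalarM => s u v.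
by rewrite brDl brZl ipDl ipZl.
Qed.

Let inner1 (v w : V) : \sum_(b <- onb ip p) ip v b * ip w b =
  \sum_(b <- onb ipW pW) ip v (i b) * ip w (i b) + (ip A A)^-1 * (ip v A * ip w A).
Proof.
apply: (@sum_onb_ext (fun b b' => ip v b * ip w b')) => c.
  by apply: scalarMr; apply: scalar_ip.
by apply: scalarM; apply: scalar_ip.
Qed.

Let inner2 (a x y : V) : \sum_(b <- onb ip p) ip (br a b) x * ip (br a b) y =
  \sum_(b <- onb ipW pW) ip (br a (i b)) x * ip (br a (i b)) y
  + (ip A A)^-1 * (ip (br a A) x * ip (br a A) y).
Proof.
apply: (@sum_onb_ext (fun b b' => ip (br a b) x * ip (br a b') y)) => c.
  by apply: scalarMr => s u v; rewrite brDr brZr ipDl ipZl.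
by apply: scalarM => s u v; rewrite brDr brZr ipDl ipZl.
Qed.

(** A contributes once to the first double sum, as the vector bracketed with x and y, and twice to
    the second, in either slot of [a, b]. The weights -1/2 and 1/4 make <Fx, Fy> and <F^t x, F^t y>
    cancel by normality. *)
Lemma mform_ext x y : x \in pW -> y \in pW ->
  mform br ip p (i x) (i y) = mform brW ipW pW x y.
Proof.
move=> xp yp; rewrite /mform.
set S1 := \sum_(a <- onb ip p) \sum_(b <- onb ip p) ip (br (i x) a) b * _.
set S2 := \sum_(a <- onb ip p) \sum_(b <- onb ip p) ip (br a b) (i x) * _.
set T1 := \sum_(a <- onb ipW pW) \sum_(b <- onb ipW pW) ipW (brW x a) b * _.
set T2 := \sum_(a <- onb ipW pW) \sum_(b <- onb ipW pW) ipW (brW a b) x * _.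
have ES1 : S1 = T1 + (ip A A)^-1 * ipW (F x) (F y).
  rewrite /S1 (sum_onb_ext (f1l _ _) (f1r _ _)); congr (_ + _ * _).
    apply: eq_bigr => a _; rewrite inner1 !i_br !A_perp' mulr0 mulr0 addr0.
    by apply: eq_bigr => b _; rewrite !i_ip.
  rewrite inner1 !br_iA !A_perp' mulr0 mulr0 addr0 -(onb_parseval ipW _ (F_p x)).
  by apply: eq_bigr => b _; rewrite !i_ip !ipNl mulrNN.
have Fsum : \sum_(a <- onb ipW pW) ipW (F a) x * ipW (F a) y = ipW (F x) (F y).
  rewrite F_normal -(onb_parseval ipW _ (Ft_p x)); apply: eq_bigr => a _.
  by rewrite [ipW (F a) x]adjointP [ipW (F a) y]adjointP [ipW a (Ft x)]ipC [ipW a (Ft y)]ipC.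
have ES2 : S2 = T2 + 2 * (ip A A)^-1 * ipW (F x) (F y).
  rewrite /S2 (sum_onb_ext (f2l _ _) (f2r _ _)) -Fsum.
  rewrite inner2 (brxx (mr_lie mr)) !ip0l mulr0 mulr0 addr0.
  under [X in X + _]eq_bigr => a _ do
    rewrite inner2 br_iA !i_ip !ipNl mulrNN.
  rewrite big_split /= -mulr_sumr.
  under [X in _ + _ * X = _]eq_bigr => b _ do rewrite brA !i_ip.
  have -> : \sum_(a <- onb ipW pW) \sum_(b <- onb ipW pW)
      ip (br (i a) (i b)) (i x) * ip (br (i a) (i b)) (i y) = T2.
    by apply: eq_bigr => a _; apply: eq_bigr => b _; rewrite i_br !i_ip.
  by ring.
by rewrite ES1 ES2; move: (ip A A)^-1 => w; field.
Qed.

Lemma ricform_ext x y : x \in pW -> y \in pW ->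
  ricform br ip p (i x) (i y) = ricform brW ipW pW x y
    - 2^-1 * (trl F / ip A A) * (ipW (F x) y + ipW x (F y)).
Proof.
move=> xp yp; rewrite /ricform mform_ext // killing_ext mean_curvW.
rewrite mean_curv_ext !br0l ip0l ip0r !brZl !brA ipZl ipZr !i_ip.
by ring.
Qed.

Hypothesis F_sym : forall x y, ipW (F x) y = ipW x (F y).
Hypothesis F_ad : {in pW, forall x, trl (ad brW x \o F)%VF = 0}.

(** The Killing form and the surviving sum of M are both tr(ad x F), the latter because F is
    symmetric; [F_ad] makes it 0. *)
Lemma ricform_ext_mixed x : x \in pW -> ricform br ip p (i x) A = 0.
Proof.
move=> xp; rewrite /ricform /killing mean_curv_ext !brZl brA.
rewrite (brxx (mr_lie mr)) scaler0 ip0r ipZl A_perp' mulr0 addr0 mulr0 subr0.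
rewrite trl_ext comp_lfunE !adE (brxx (mr_lie mr)) br0r ip0l mulr0 addr0.
under eq_bigr => a _ do rewrite comp_lfunE !adE brA i_br i_ip -adE -comp_lfunE.
rewrite -trl_onb F_ad // mulr0 subr0 /mform.
rewrite [X in 4^-1 * X]big1; last first.
  by move=> a _; rewrite big1 // => b _; rewrite ip_brA mulr0.
rewrite mulr0 addr0 (sum_onb_ext (f1l _ _) (f1r _ _)).
under eq_bigr => a _ do rewrite inner1 ip_brA mul0r mulr0 addr0 i_br brA.
rewrite inner1 !ip_brA (brxx (mr_lie mr)) mulr0 mulr0 addr0.
rewrite [X in _ * (_ + _ * X)]big1 => [|a _]; last by rewrite ip0l mulr0.
rewrite mulr0 addr0.
suff -> : \sum_(a <- onb ipW pW) \sum_(b <- onb ipW pW)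
    ip (i (brW x a)) (i b) * ip (i (F a)) (i b) = trl (F \o ad brW x)%VF.
  by rewrite trlC F_ad // mulr0.
rewrite (trl_onb_p mrW); last by move=> v; rewrite comp_lfunE F_p.
apply: eq_bigr => a _; under eq_bigr => b _ do rewrite !i_ip mulrC.
by rewrite onb_parseval // comp_lfunE adE F_sym ipC.
Qed.

(** M and the Killing term contribute -tr F^2 / 2 each, and ad H kills A because H is a multiple of
    A. *)
Lemma ricform_ext_normal : ricform br ip p A A = - trl (F \o F)%VF.
Proof.
rewrite /ricform /killing mean_curv_ext !brZl.
rewrite (brxx (mr_lie mr)) scaler0 ip0r ip0l addr0 mulr0 subr0.
rewrite trl_ext comp_lfunE !adE (brxx (mr_lie mr)) br0r ip0l mulr0 addr0.
under eq_bigr => a _ do rewrite comp_lfunE !adE !brA i_ip -comp_lfunE.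
rewrite -trl_onb /mform.
rewrite [X in 4^-1 * X]big1; last first.
  by move=> a _; rewrite big1 // => b _; rewrite ip_brA mulr0.
rewrite mulr0 addr0 (sum_onb_ext (f1l _ _) (f1r _ _)).
under eq_bigr => a _ do rewrite inner1 ip_brA mul0r mulr0 addr0 brA.
rewrite inner1 !ip_brA (brxx (mr_lie mr)) mulr0 mulr0 addr0.
rewrite [X in _ * (_ + _ * X)]big1 => [|a _]; last by rewrite ip0l mulr0.
rewrite mulr0 addr0.
suff -> : \sum_(a <- onb ipW pW) \sum_(b <- onb ipW pW)
    ip (i (F a)) (i b) * ip (i (F a)) (i b) = trl (F \o F)%VF.
  by field; rewrite ?pnatr_eq0.
rewrite (trl_onb_p mrW); last by move=> v; rewrite comp_lfunE F_p.
apply: eq_bigr => a _; under eq_bigr => b _ do rewrite !i_ip mulrC.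
by rewrite onb_parseval // comp_lfunE [RHS]F_sym.
Qed.

(** The first condition says that the excess of Ric_W over c I is what the mean curvature term
    removes; the second settles the direction A. *)
Lemma einstein_ext c :
  {in pW &, forall x y, ricform brW ipW pW x y
     = c * ipW x y + trl F / ip A A * ipW (F x) y} ->
  trl (F \o F)%VF = - c * ip A A ->
  einstein_with br ip k p c.
Proof.
move=> ricW trF2 x xp; apply/(ricci_eqP mr) => //; first exact: memvZ.
move=> y yp; have [x' x'p ->] := p_decomp xp; have [y' y'p ->] := p_decomp yp.
set s := _ / _; set t := _ / _; rewrite ![i _ + _]addrC.
rewrite ricform_scalar [ricform _ _ _ _ A]ricformC.
rewrite [ricform _ _ _ _ (i y')]ricformC !ricform_scalar.
rewrite ricform_ext_normal ricform_ext // [ricform _ _ _ A _]ricformC.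
rewrite !ricform_ext_mixed // ricW // trF2 F_sym.
rewrite !(ipDl, ipDr, ipZl, ipZr) A_perp A_perp' i_ip [ipW y' x']ipC.
by move: (ip A A)^-1 => w; field.
Qed.

End CodimensionOne.

(** * Nilsolitons *)

Section Filtration.
Variables (R : realType) (V : vectType R).

(** No adapted basis is chosen. As T sends [U j] into [U j.+1], projecting T proj_j to [U j.+1]
    changes nothing; by cyclicity this outer projection moves to the right, where it absorbs
    proj_j. *)
Lemma trl_filtration (U : nat -> {vspace V}) (T : 'End(V)) m :
  U 0%N = fullv -> U m = 0%VS -> (forall j, (U j.+1 <= U j)%VS) ->
  (forall j, {in U j, forall x, T x \in U j.+1}) -> trl T = 0.
Proof.
move=> U0 Um Uj TU.
have step j : trl (T \o projv (U j))%VF = trl (T \o projv (U j.+1))%VF.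
  have -> : (T \o projv (U j) = projv (U j.+1) \o (T \o projv (U j)))%VF.
    apply/lfunP => x; have TUx := TU j _ (memv_proj (U j) x).
    by rewrite !comp_lfunE [projv (U j.+1) _]projv_id.
  rewrite trlC; congr trl; apply/lfunP => x; rewrite !comp_lfunE.
  by rewrite [projv (U j) _]projv_id // (subvP (Uj j)) // memv_proj.
have all j : trl T = trl (T \o projv (U j))%VF.
  elim: j => [|j ->]; last exact: step.
  by congr trl; apply/lfunP => x; rewrite comp_lfunE projv_id // U0 memvf.
rewrite (all m) (_ : (_ \o _)%VF = 0) ?trl0 //; apply/lfunP => x.
have := memv_proj (U m) x; rewrite {2}Um memv0 comp_lfunE => /eqP ->.
by rewrite linear0 zero_lfunE.
Qed.

Variable br : {bilinear V -> V -> V}.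

Lemma mem_brv (U W : {vspace V}) x y : x \in U -> y \in W ->
  br x y \in brv br U W.
Proof.
move=> xU yW; rewrite (coord_vbasis xU) (coord_vbasis yW).
rewrite linear_sumlz rpred_sum // => i _ /=; rewrite linear_sumr rpred_sum // => j _.
rewrite brZl brZr !memvZ // memv_span //.
by apply: allpairs_f; rewrite mem_nth // size_tuple.
Qed.

Lemma brv_sub (U W Z : {vspace V}) :
  {in U & W, forall x y, br x y \in Z} -> (brv br U W <= Z)%VS.
Proof.
move=> h; apply/span_subvP => _ /allpairsP[[x y] /= [xU yW ->]].
by apply: h; apply: vbasis_mem.
Qed.

Definition lcs j : {vspace V} := iter j (brv br fullv) fullv.

Lemma lcs_br j x y : y \in lcs j -> br x y \in lcs j.+1.
Proof. by move=> yj; apply: mem_brv; rewrite ?memvf. Qed.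

Lemma lcs_sub j : (lcs j.+1 <= lcs j)%VS.
Proof.
elim: j => [|j IHj]; first exact: subvf.
by apply: brv_sub => x y _ yj; apply: lcs_br; apply: (subvP IHj).
Qed.

Lemma lcs_derivation (D : 'End(V)) j x : derivation br D ->
  x \in lcs j -> D x \in lcs j.
Proof.
move=> derD; elim: j x => [|j IHj] x; first by move=> _; apply: memvf.
suff /subvP/(_ x) : (lcs j.+1 <= D @^-1: lcs j.+1)%VS.
  by move=> h /h; rewrite -memv_preim.
apply: brv_sub => u v _ vj; rewrite -memv_preim derD.
by rewrite rpredD ?lcs_br // IHj.
Qed.

End Filtration.

Section Nilsoliton.
Variables (R : realType) (V : vectType R) (br : {bilinear V -> V -> V}).
Variables (ip : {dot V for @idfun R}).

Section Nilpotent.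
Hypotheses (Lbr : lie_bracket br) (nil : nilpotent_lie br).

Lemma metric_reductive_full : metric_reductive br ip 0%VS fullv.
Proof.
split=> //; rewrite ?add0v ?cap0v //.
- by move=> x y /[!memv0] /eqP -> _; rewrite br0l eqxx.
- by move=> x y _ _; rewrite memvf.
- by move=> x y /[!memv0] /eqP -> _; rewrite ip0l.
by move=> x /[!memv0] /eqP -> y z; rewrite !br0l ip0l ip0r oppr0.
Qed.

Lemma trl_lcs (T : 'End(V)) : 
  (forall j, {in lcs br j, forall x, T x \in lcs br j.+1}) -> trl T = 0.
Proof. by have [m Um] := nil; apply: (trl_filtration _ Um) => //; apply: lcs_sub. Qed.

Lemma nil_trl_ad x : trl (ad br x) = 0.
Proof. by apply: trl_lcs => j y yj; rewrite adE lcs_br. Qed.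

(** ad x moves down the lower central series and a derivation preserves each of its terms. *)
Lemma nil_trl_der_ad D x : derivation br D -> trl (D \o ad br x)%VF = 0.
Proof.
move=> derD; apply: trl_lcs => j y yj; rewrite comp_lfunE adE.
by rewrite lcs_derivation ?lcs_br.
Qed.

Lemma nil_killing x y : killing br x y = 0.
Proof.
apply: trl_lcs => j z zj; rewrite comp_lfunE !adE.
by apply: (subvP (lcs_sub _ _)); rewrite !lcs_br.
Qed.

(** Nilpotency kills both the Killing form and H, so Ric = M; a nilsoliton thus has M = c I + D1. *)
Lemma nil_ricform x y : ricform br ip fullv x y = mform br ip fullv x y.
Proof.
rewrite /ricform nil_killing.
rewrite (mean_curv_eq metric_reductive_full (mem0v _)); last first.
  by move=> z _; rewrite ip0l nil_trl_ad.
by rewrite !br0l ip0l ip0r addr0 !mulr0 !subr0.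
Qed.

(** The last nonzero term of the lower central series is central. *)
Lemma nil_center : fullv != 0%VS :> {vspace V} ->
  exists2 z, z != 0 & forall x, br x z = 0.
Proof.
move=> V0; have [m Um] := nil.
elim: m Um => [|m IHm] Um; first by case/eqP: V0; apply: Um.
have [/IHm //|Um0] := eqVneq (lcs br m) 0%VS.
exists (vpick (lcs br m)); rewrite ?vpick0 // => x.
by apply/eqP; rewrite -memv0 -Um; apply: lcs_br; apply: memv_pick.
Qed.

End Nilpotent.

(** * The moment map identity *)

Section Moment.
Hypothesis Lbr : lie_bracket br.

Local Notation X := (onb ip {:V}).
Local Notation adj := (adjoint ip).

(** The infinitesimal action E . mu of gl(n) on the bracket mu. *)
Definition defect (E : 'End(V)) x y := E (br x y) - br (E x) y - br x (E y).

Lemma derivationP E : derivation br E <-> forall x y, defect E x y = 0.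
Proof.
rewrite /defect; split=> h x y; first by rewrite h -addrA -opprD subrr.
by apply/eqP; rewrite -subr_eq0 opprD addrA; apply/eqP; apply: h.
Qed.

Lemma sum_onb_adjoint (g : V -> V -> R) (E : 'End(V)) :
  (forall y, scalar (g^~ y)) -> (forall x, scalar (g x)) ->
  \sum_(a <- X) g a (E a) = \sum_(a <- X) g (adj E a) a.
Proof.
move=> gl gr.
transitivity (\sum_(a <- X) \sum_(b <- X) ip (E a) b * g a b).
  apply: eq_bigr => a _; rewrite [in LHS](onb_expand ip (memvf (E a))).
  exact: (scalar_comb _ _ _ (gr a)).
rewrite exchange_big; apply: eq_bigr => b _ /=.
rewrite [in RHS](onb_expand ip (memvf (adj E b))) (scalar_comb _ _ _ (gl b)).
by apply: eq_bigr => a _; rewrite adjointP [ip a _]ipC.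
Qed.

(** M is the moment map of the action on brackets: tr(M E) = <mu, E . mu> / 4. The first sum of M
    supplies the terms [Ea, b] and [a, Eb], equal in total by antisymmetry; the second supplies
    E[a, b]. *)
Lemma sum_mform (E : 'End(V)) : \sum_(x <- X) mform br ip fullv (E x) x =
  4^-1 * \sum_(a <- X) \sum_(b <- X) ip (br a b) (defect E a b).
Proof.
rewrite /mform big_split /= -!mulr_sumr.
have -> : \sum_(x <- X) \sum_(a <- X) \sum_(b <- X)
    ip (br (E x) a) b * ip (br x a) b
  = \sum_(x <- X) \sum_(a <- X) ip (br x a) (br (E x) a).
  apply: eq_bigr => x _; apply: eq_bigr => a _.
  by rewrite onb_parseval ?memvf // ipC.
have -> : \sum_(x <- X) \sum_(a <- X) \sum_(b <- X)
    ip (br a b) (E x) * ip (br a b) x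
  = \sum_(a <- X) \sum_(b <- X) ip (br a b) (E (br a b)).
  rewrite exchange_big; apply: eq_bigr => a _ /=.
  rewrite exchange_big; apply: eq_bigr => b _ /=.
  rewrite -[RHS]adjointPr -(onb_parseval _ _ (memvf (adj E (br a b)))).
  by apply: eq_bigr => x _; rewrite adjointPr.
have sw : \sum_(a <- X) \sum_(b <- X) ip (br a b) (br a (E b))
        = \sum_(a <- X) \sum_(b <- X) ip (br a b) (br (E a) b).
  rewrite exchange_big; apply: eq_bigr => a _; apply: eq_bigr => b _ /=.
  by rewrite (brC Lbr b a) (brC Lbr b (E a)) ipNl ipNr opprK.
have -> : \sum_(a <- X) \sum_(b <- X) ip (br a b) (defect E a b)
  = \sum_(a <- X) \sum_(b <- X) ip (br a b) (E (br a b))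
  - \sum_(a <- X) \sum_(b <- X) ip (br a b) (br (E a) b)
  - \sum_(a <- X) \sum_(b <- X) ip (br a b) (br a (E b)).
  rewrite -!sumrB; apply: eq_bigr => a _; rewrite -!sumrB.
  by apply: eq_bigr => b _; rewrite !ipBr.
by rewrite sw; field.
Qed.

(** [E, F] . mu = E . (F . mu) because E . mu = 0; on the right E acts on the bilinear map F .
    mu. *)
Lemma defect_commutator (E F : 'End(V)) a b : derivation br E ->
  defect ((E \o F) - (F \o E))%VF a b =
  E (defect F a b) - defect F (E a) b - defect F a (E b).
Proof.
move=> derE; rewrite /defect !add_lfunE !opp_lfunE !comp_lfunE.
rewrite !brDl !brDr !brNl !brNr derE !linearB /= !linearD /= !derE.
by apply: (@ip_inj _ _ ip) => z; rewrite !(ipDl, ipNl); ring.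
Qed.

Lemma defect_scalarl (F : 'End(V)) v b : scalar (fun a => ip v (defect F a b)).
Proof.
move=> s x y; rewrite /defect [F (s *: _ + _)]linearP /= !brDl !brZl [F (_ + _)]linearP /=.
by rewrite !(ipDr, ipNr, ipZr); ring.
Qed.

Lemma defect_scalarr (F : 'End(V)) v a : scalar (fun b => ip v (defect F a b)).
Proof.
move=> s x y; rewrite /defect [F (s *: _ + _)]linearP /= !brDr !brZr [F (_ + _)]linearP /=.
by rewrite !(ipDr, ipNr, ipZr); ring.
Qed.

(** On bilinear maps the action of E^t is adjoint to that of E, so <mu, E . (F . mu)> = <E^t . mu, F
    . mu>. *)
Lemma sum_defect_commutator (E F : 'End(V)) : derivation br E ->
  \sum_(a <- X) \sum_(b <- X)
     ip (br a b) (defect ((E \o F) - (F \o E))%VF a b) =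
  \sum_(a <- X) \sum_(b <- X) ip (defect (adj E) a b) (defect F a b).
Proof.
move=> derE.
have s1 : \sum_(a <- X) \sum_(b <- X) ip (br a b) (defect F (E a) b) =
    \sum_(a <- X) \sum_(b <- X) ip (br (adj E a) b) (defect F a b).
  apply: (sum_onb_adjoint (g := fun a a' => \sum_(b <- X) ip (br a b) (defect F a' b))) => c.
    by apply: scalar_sum => b s x y; rewrite brDl brZl ipDl ipZl.
  by apply: scalar_sum => b; apply: defect_scalarl.
have s2 : \sum_(a <- X) \sum_(b <- X) ip (br a b) (defect F a (E b)) =
    \sum_(a <- X) \sum_(b <- X) ip (br a (adj E b)) (defect F a b).
  apply: eq_bigr => a _.
  apply: (sum_onb_adjoint (g := fun b b' => ip (br a b) (defect F a b'))) => c.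
    by move=> s x y; rewrite brDr brZr ipDl ipZl.
  exact: defect_scalarr.
transitivity (\sum_(a <- X) \sum_(b <- X) ip (br a b) (E (defect F a b))
  - \sum_(a <- X) \sum_(b <- X) ip (br a b) (defect F (E a) b)
  - \sum_(a <- X) \sum_(b <- X) ip (br a b) (defect F a (E b))).
  rewrite -!sumrB; apply: eq_bigr => a _; rewrite -!sumrB.
  by apply: eq_bigr => b _; rewrite defect_commutator // !ipBr.
rewrite s1 s2 -!sumrB; apply: eq_bigr => a _; rewrite -!sumrB.
by apply: eq_bigr => b _; rewrite -adjointPr -!ipBl.
Qed.

End Moment.

(** * Consequences of the nilsoliton equation *)

Section Soliton.
Variables (c : R) (D1 : 'End(V)).
Hypothesis ns : nilsoliton br ip c D1.

Let Lbr := ns_lie ns.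
Let nil := ns_nil ns.
Local Notation X := (onb ip {:V}).
Local Notation adj := (adjoint ip).
Local Notation M := (c *: \1%VF + D1).

Lemma ns_mform x y : mform br ip fullv x y = c * ip x y + ip (D1 x) y.
Proof.
rewrite -(nil_ricform Lbr nil) -(ip_ricci (metric_reductive_full Lbr)) ?memvf //.
by rewrite (ns_ricci ns) ipDl ipZl.
Qed.

Lemma ns_sym x y : ip (D1 x) y = ip x (D1 y).
Proof.
have : mform br ip fullv x y = mform br ip fullv y x.
  by rewrite -!(nil_ricform Lbr nil) ricformC.
by rewrite !ns_mform [ip y x]ipC [ip (D1 y) x]ipC => /addrI.
Qed.

Lemma ns_moment E : c * trl E + trl (D1 \o E)%VF =
  4^-1 * \sum_(a <- X) \sum_(b <- X) ip (br a b) (defect E a b).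
Proof.
rewrite -(sum_mform Lbr) !(trl_onb ip) mulr_sumr -big_split.
by apply: eq_bigr => x _; rewrite ns_mform comp_lfunE.
Qed.

(** M is orthogonal to derivations: tr(M E) = <mu, E . mu> / 4 = 0, where M = c I + D1. *)
Lemma ns_trl_derivation E : derivation br E -> trl (D1 \o E)%VF = - c * trl E.
Proof.
move=> /derivationP dE; apply/eqP; rewrite mulNr -subr_eq0 opprK addrC ns_moment.
rewrite big1 ?mulr0 // => a _; rewrite big1 // => b _.
by rewrite dE ip0r.
Qed.

Lemma ns_moment_commutator E F : derivation br E ->
  trl (D1 \o ((E \o F) - (F \o E)))%VF =
  4^-1 * \sum_(a <- X) \sum_(b <- X) ip (defect (adj E) a b) (defect F a b).
Proof.
move=> derE; rewrite -sum_defect_commutator // -ns_moment.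
by rewrite trlD trlN [trl (E \o F)%VF]trlC subrr mulr0 add0r.
Qed.

(** For every F, tr([D1, E] F) = tr(D1 [E, F]) = <E^t . mu, F . mu> / 4 = 0, and the trace pairing
    is nondegenerate. *)
Lemma ns_commute E : derivation br E -> derivation br (adj E) ->
  (E \o D1 = D1 \o E)%VF.
Proof.
move=> derE /derivationP derEt; apply/eqP; rewrite eq_sym -subr_eq0; apply/eqP.
apply: (@trl_eq0_all _ _ ip) => F.
have := ns_moment_commutator F derE.
rewrite [X in _ = _ * X]big1 => [|a _]; last first.
  by rewrite big1 // => b _; rewrite derEt ip0l.
rewrite mulr0 => <-.
rewrite !(comp_lfunDl, comp_lfunDr, comp_lfunNl, comp_lfunNr) !trlD !trlN.
by rewrite !compA [trl (E \o _)%VF]trlC compA.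
Qed.

(* The trace of M [E, E^t] is a quarter of the square norm of the defect of
   E^t, so that these defects vanish when the commutators add up to 0. *)
Lemma ns_adjoint_derivation (I : eqType) (s : seq I) (E : I -> 'End(V)) :
  (forall i, derivation br (E i)) ->
  \sum_(i <- s) ((E i \o adj (E i))%VF - (adj (E i) \o E i)%VF) = 0 ->
  {in s, forall i, derivation br (adj (E i))}.
Proof.
move=> derE sum0.
pose q i := \sum_(a <- X) \sum_(b <- X)
  ip (defect (adj (E i)) a b) (defect (adj (E i)) a b).
have q_ge0 i : 0 <= q i.
  by apply: sumr_ge0 => a _; apply: sumr_ge0 => b _; apply: ip_ge0.
have trD1 : scalar (fun T : 'End(V) => trl (D1 \o T)%VF).
  by move=> a S T; rewrite comp_lfunDr -comp_lfunZr trlD trlZ.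
have q0 : \sum_(i <- s) q i = 0.
  apply: (@mulfI _ 4^-1); rewrite ?invr_eq0 ?pnatr_eq0 // mulr0 mulr_sumr.
  transitivity (trl (D1 \o \sum_(i <- s)
      ((E i \o adj (E i))%VF - (adj (E i) \o E i)%VF))%VF).
    under [in RHS]eq_bigr do rewrite -[_ - _]scale1r.
    rewrite (scalar_comb s (fun=> 1) _ trD1); apply: eq_bigr => i _.
    by rewrite mul1r ns_moment_commutator.
  by rewrite sum0 comp_lfun0r trl0.
move=> i si; apply/derivationP.
have {q0} qi0 : q i = 0.
  move/eqP: q0; rewrite psumr_eq0 => [/allP /(_ i si) /eqP //|j _]; exact: q_ge0.
have d0 a b : a \in X -> b \in X -> defect (adj (E i)) a b = 0.
  move=> aX bX; move/eqP: qi0; rewrite psumr_eq0; last first.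
    by move=> ? _; apply: sumr_ge0 => ? _; apply: ip_ge0.
  move=> /allP /(_ a aX) /=; rewrite psumr_eq0; last by move=> ? _; apply: ip_ge0.
  by move=> /allP /(_ b bX) /=; rewrite ip_eq0 => /eqP.
move=> x y; apply: (@ip_inj _ _ ip) => z; rewrite ip0l ipC.
rewrite (onb_expand ip (memvf x)) (scalar_comb _ _ _ (defect_scalarl _ z y)).
rewrite big_seq big1 // => a aX; rewrite (onb_expand ip (memvf y)).
rewrite (scalar_comb _ _ _ (defect_scalarr _ z a)) big_seq big1 ?mulr0 // => b bX.
by rewrite d0 // ip0r mulr0.
Qed.

(** From 0 <= tr D1^2 = -c tr D1 the trace is nonnegative. If it were 0, then D1 = 0 and M = c I
    would be negative; but at a central vector the negative part of M vanishes, so M is nonnegative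
    there. *)
Lemma ns_trl_gt0 : fullv != 0%VS :> {vspace V} -> 0 < trl D1.
Proof.
move=> V0; have c0 := ns_c ns.
have trD12 := ns_trl_derivation (ns_der ns).
have D1t : adj D1 = D1 by apply: adjoint_eq => x y; rewrite ns_sym.
have sq0 := trl_sqr_ge0 ip D1; rewrite D1t trD12 in sq0.
rewrite lt_def; apply/andP; split; last first.
  by rewrite -(@pmulr_rge0 _ (- c)) // oppr_gt0.
apply/eqP => tr0.
have D10 : D1 = 0 by apply: (trl_sqr_eq0 (ip := ip)); rewrite D1t trD12 tr0 mulr0.
have [z z0 zC] := nil_center nil V0.
have zz : 0 < ip z z by rewrite lt_def ip_eq0 z0 ip_ge0.
have : 0 <= c * ip z z.
  have := ns_mform z z; rewrite D10 zero_lfunE ip0l addr0 => <-.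
  rewrite /mform big1 => [|a _]; last first.
    by rewrite big1 // => b _; rewrite (brC Lbr z) zC oppr0 ip0l mulr0.
  rewrite mulr0 add0r mulr_ge0 ?invr_ge0 //.
  by apply: sumr_ge0 => a _; apply: sumr_ge0 => b _; rewrite -expr2 sqr_ge0.
by rewrite leNgt nmulr_rlt0 // zz.
Qed.

End Soliton.
End Nilsoliton.

(** * Changing the action of the mean curvature vector *)

Section DerivationExtension.
Variables (R : realType) (V : vectType R) (br : {bilinear V -> V -> V}).
Variables (ip : {dot V for @idfun R}) (E : 'End(V)).
Hypotheses (Lbr : lie_bracket br) (derE : derivation br E).

(** [w a b s t] is the V-component of the bracket of (s, a) and (t, b) in the semidirect product of
    a line with V through [E]. Brackets have line coefficient 0, whence the zeros in the outer
    brackets. *)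
Lemma derivation_ext_jacobi (r s t : R) (x y z : V) :
  let w a b s t := br a b + (s *: E b - t *: E a) in
  w x (w y z s t) r 0 + w y (w z x t r) s 0 + w z (w x y r s) t 0 = 0.
Proof.
move=> w; rewrite /w !scale0r !subr0.
have J : br x (br y z) + br y (br z x) + br z (br x y) = 0.
  by have [_] := Lbr; apply.
rewrite !(linearD E) !(linearN E) !(linearZ_LR E) /= !derE.
rewrite !brDr !brNr !brZr (brC Lbr z (E y)) (brC Lbr x (E z)) (brC Lbr y (E x)).
apply: (@ip_inj _ _ ip) => v; move/(congr1 (ip^~ v)): J.
rewrite !(ipDl, ipZl, ipNl) ip0l => J.
by rewrite -[RHS]J; ring.
Qed.

End DerivationExtension.

(** * Restriction to subspaces, and products *)

Section Subspace.
Variables (R : realType) (V : vectType R) (U : {vspace V}).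

(** T factors as the inclusion of U after a map to U; composing the two in the other order gives
    T'. *)
Lemma trl_restrict (T : 'End(V)) (T' : 'End(subvs_of U)) :
  (forall x, T x \in U) -> (forall x, vsval (T' x) = T (vsval x)) ->
  trl T' = trl T.
Proof.
move=> TU T'E.
pose i : 'Hom(subvs_of U, V) := linfun vsval.
pose q : 'Hom(V, subvs_of U) := (linfun (vsproj U) \o T)%VF.
have -> : T = (i \o q)%VF.
  by apply/lfunP => x; rewrite !comp_lfunE !lfunE /= vsprojK.
rewrite trlC; congr trl; apply/lfunP => x.
by apply: subvs_inj; rewrite T'E !comp_lfunE !lfunE /= vsprojK.
Qed.

Variables (br : {bilinear V -> V -> V}) (ip : {dot V for @idfun R}).
Variables (k p : {vspace V}).
Hypothesis mr : metric_reductive br ip k p.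
Hypothesis brU : forall x y, br x y \in U.
Hypothesis kU : (k <= U)%VS.

Lemma res_bracketE x y :
  vsval (res_bracket U br x y) = br (vsval x) (vsval y).
Proof. by rewrite /res_bracket vsprojK. Qed.

Lemma mem_res_vspace (W : {vspace V}) (x : subvs_of U) :
  (x \in res_vspace U W) = (vsval x \in W).
Proof. by rewrite /res_vspace -memv_preim lfunE. Qed.

Lemma res_endE (T : 'End(V)) x : T (vsval x) \in U ->
  vsval (res_end U T x) = T (vsval x).
Proof. by move=> TU; rewrite /res_end lfunE /= vsprojK. Qed.

(** Because k lies in U, the p-component of a vector of U stays in U, so U still splits. *)
Lemma metric_reductive_res : metric_reductive (res_bracket U br) (res_ip U ip)
  (res_vspace U k) (res_vspace U p).
Proof.
split.
- split=> [x|x y z]; apply: subvs_inj; first by rewrite /= res_bracketE (brxx (mr_lie mr)).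
  by rewrite /= !res_bracketE; have [_] := mr_lie mr; apply.
- apply/eqP; rewrite eqEsubv subvf; apply/subvP => x _.
  have zU : daddv_pi k p (vsval x) \in U by rewrite (subvP kU) // memv_pi.
  have xE := mr_decomp mr (vsval x).
  have yU : daddv_pi p k (vsval x) \in U.
    by rewrite -[X in X \in _](addrK (daddv_pi k p (vsval x))) -xE rpredB // subvsP.
  apply/memv_addP; exists (vsproj U (daddv_pi k p (vsval x))).
    by rewrite mem_res_vspace vsprojK // memv_pi.
  exists (vsproj U (daddv_pi p k (vsval x))).
    by rewrite mem_res_vspace vsprojK // memv_pi.
  by apply: subvs_inj; rewrite /= !vsprojK // addrC.
- apply/eqP; rewrite -subv0; apply/subvP => x; rewrite memv_cap !mem_res_vspace.
  rewrite -memv_cap (mr_direct mr) !memv0 => /eqP x0.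
  by apply/eqP/subvs_inj.
- by move=> x y; rewrite !mem_res_vspace res_bracketE; apply: mr_subalg mr _ _.
- by move=> x y; rewrite !mem_res_vspace res_bracketE; apply: mr_stable mr _ _.
- by move=> x y; rewrite !mem_res_vspace; apply: mr_ortho mr _ _.
move=> z; rewrite mem_res_vspace => zk x y.
by rewrite /= /res_ip !res_bracketE (mr_skew mr).
Qed.

End Subspace.

Section Prodv.
Variables (R : realType) (U W : vectType R).

Lemma mem_prodv (A : {vspace U}) (B : {vspace W}) (x : (U * W)%type) :
  (x \in prodv A B) = (x.1 \in A) && (x.2 \in B).
Proof. by rewrite /prodv memv_cap -!memv_preim !lfunE. Qed.

Variables (ipU : {dot U for @idfun R}) (ipW : {dot W for @idfun R}).

Lemma trl_prod (T : 'End((U * W)%type)) (TU : 'End(U)) (TW : 'End(W)) :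
  (forall a, (T (a, 0)).1 = TU a) -> (forall b, (T (0, b)).2 = TW b) ->
  trl T = trl TU + trl TW.
Proof.
move=> TUE TWE.
pose phi (o : U + W) (v : (U * W)%type) :=
  match o with inl a => ipU v.1 a | inr b => ipW v.2 b end.
pose e (o : U + W) : (U * W)%type :=
  match o with inl a => (a, 0) | inr b => (0, b) end.
rewrite (@trl_frame _ _ T _ (map inl (onb ipU fullv) ++ map inr (onb ipW fullv)) phi e).
- rewrite big_cat /= !big_map (trl_onb ipU) (trl_onb ipW) /=.
  by congr (_ + _); apply: eq_bigr => a _; rewrite ?TUE ?TWE.
- by move=> [a|b] s x y /=; rewrite ipDl ipZl.
move=> [u w]; rewrite big_cat /= !big_map /=.
rewrite {1}(onb_expand ipU (memvf u)) {1}(onb_expand ipW (memvf w)).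
elim: (tval (onb ipU fullv)) => [|a s IHs].
  rewrite !big_nil add0r; elim: (tval (onb ipW fullv)) => [|b s IHs].
    by rewrite !big_nil.
  by rewrite !big_cons -IHs; congr pair; rewrite /= scaler0 addr0.
rewrite !big_cons -addrA -IHs; congr pair => /=.
by rewrite scaler0 add0r.
Qed.

End Prodv.

Lemma sqr_div_sqrt (R : realType) (a b : R) : 0 <= a -> 0 <= b ->
  (Num.sqrt a / Num.sqrt b) ^+ 2 = a / b.
Proof. by move=> a0 b0; rewrite expr_div_n !sqr_sqrtr. Qed.

(** * The three claims, for an abstract D0 with the properties that the construction supplies *)

Section AlgebraicSoliton.
Variables (R : realType) (V : vectType R).
Variables (br : {bilinear V -> V -> V}) (ip : {dot V for @idfun R}).
Variables (k p : {vspace V}) (c : R) (D0 : 'End(V)).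
Local Notation H := (mean_curv br ip p).
Local Notation SH := (symm ip (ad br H)).
Local Notation D := (- SH + D0).
Local Notation g0 := (orthov ip <[H]>%VS).
Hypothesis mr : metric_reductive br ip k p.
Hypothesis sol : algebraic_soliton_with br ip k p c D.
Hypothesis D0_der : derivation br D0.
Hypothesis D0_k : {in k, forall z, D0 z = 0}.
Hypothesis D0_H : D0 H = 0.
Hypothesis D0_ad : forall x, ip x H = 0 -> trl (D0 \o ad br x)%VF = 0.
Hypothesis D0_sq : trl (D0 \o D0)%VF = - c * trl D0.

Let Lbr := mr_lie mr.

Lemma sol_D0_sym x y : ip (D0 x) y = ip x (D0 y).
Proof.
have := (symmP ip D).1 (as_sym sol) x y.
rewrite !add_lfunE !opp_lfunE !(ipDl, ipDr, ipNl, ipNr) symm_sym.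
by move/addrI.
Qed.

Lemma sol_SH_der : derivation br SH.
Proof.
have -> : SH = D0 - D by rewrite opprD opprK addrCA subrr addr0.
move=> x y; rewrite !add_lfunE [(- D) _]opp_lfunE D0_der (as_der sol).
rewrite opp_lfunE [(- D) y]opp_lfunE !(brDl, brDr, brNl, brNr).
by rewrite opprD addrACA.
Qed.

Lemma sol_D_H : D H = 0.
Proof. exact: (derivation_mean_curv mr (as_der sol) (as_sym sol)). Qed.

Lemma sol_SH_H : SH H = 0.
Proof.
have := sol_D_H; rewrite add_lfunE opp_lfunE D0_H addr0 => /eqP.
by rewrite oppr_eq0 => /eqP.
Qed.

Lemma sol_ad_normal x y : ip (br H x) (br H y) =
  ip (adjoint ip (ad br H) x) (adjoint ip (ad br H) y).
Proof.
have adjE v : adjoint ip (ad br H) v = 2 *: SH v - br H v.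
  rewrite symmE scalerA mulfV ?pnatr_eq0 // scale1r adE.
  by rewrite addrAC subrr add0r.
have comm v : SH (br H v) = br H (SH v) by rewrite sol_SH_der sol_SH_H br0l add0r.
rewrite -[in LHS]adE adjointP adjointPr adE [in RHS]adjE brDr brNr brZr -comm.
by rewrite [in LHS]adjE.
Qed.

Lemma sol_k_g0 : (k <= g0)%VS.
Proof.
apply/subvP => z zk; rewrite mem_perp; apply/eqP.
by rewrite (mr_ortho mr) //; case: (mean_curvP mr).
Qed.

Lemma sol_br_g0 x y : br x y \in g0.
Proof. by rewrite mem_perp ipC (mean_curv_bracket mr). Qed.

Lemma sol_D0_g0 x : D0 x \in g0.
Proof. by rewrite mem_perp sol_D0_sym D0_H ip0r. Qed.

Lemma sol_SH_g0 x : SH x \in g0.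
Proof. by rewrite mem_perp symm_sym sol_SH_H ip0r. Qed.

Lemma sol_D_g0 x : D x \in g0.
Proof. by rewrite add_lfunE opp_lfunE rpredD ?rpredN ?sol_SH_g0 ?sol_D0_g0. Qed.

Local Notation br0 := (res_bracket g0 br).
Local Notation ip0 := (res_ip g0 ip).
Local Notation k0 := (res_vspace g0 k).
Local Notation p0 := (res_vspace g0 p).

Lemma sol_mr0 : metric_reductive br0 ip0 k0 p0.
Proof. exact: metric_reductive_res mr sol_br_g0 sol_k_g0. Qed.

Lemma sol_g0_unimodular : unimodular br0.
Proof.
move=> x; rewrite (@trl_restrict _ _ _ (ad br (vsval x))).
- have [_ <-] := mean_curvP mr.
  by have := subvsP x; rewrite mem_perp ipC => /eqP.
- by move=> y; rewrite adE sol_br_g0.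
by move=> y; rewrite !adE (res_bracketE sol_br_g0).
Qed.

Lemma g0_span v :
  exists w : subvs_of g0, v = vsval w + (ip v H / ip H H) *: H.
Proof.
have vU : v - (ip v H / ip H H) *: H \in g0.
  rewrite mem_perp ipBl ipZl subr_eq0 eq_sym.
  have [->|H0] := eqVneq H 0; first by rewrite !ip0r mulr0.
  by rewrite divfK // ip_eq0.
by exists (vsproj g0 (v - (ip v H / ip H H) *: H)); rewrite vsprojK // addrNK.
Qed.

Lemma res_endD (S T : 'End(V)) x :
  (res_end g0 S + res_end g0 T) x = res_end g0 (S + T) x.
Proof.
rewrite add_lfunE /res_end !lfunE /= -linearD /=; congr (vsproj _ _).
by rewrite lfunE.
Qed.

Lemma adjoint_res (T : 'End(V)) :
  (forall x, T x \in g0) -> (forall x, adjoint ip T x \in g0) ->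
  forall x, vsval (adjoint ip0 (res_end g0 T) x) = adjoint ip T (vsval x).
Proof.
move=> T0 Tt0 x; rewrite -res_endE //; congr (vsval _).
apply: (@ip_inj _ _ ip0) => y; rewrite adjointPr /= /res_ip !res_endE //.
by rewrite adjointPr.
Qed.

(** With F = ad H on g0, tr F = tr ad H = <H, H>, so the coefficient in [ricform_ext] is 1 and its
    term -S(ad H) cancels the one in D. *)
Lemma sol_ricform0 x y : x \in p0 -> y \in p0 ->
  ricform br0 ip0 p0 x y
  = c * ip0 x y + ip (D0 (vsval x)) (vsval y).
Proof.
have adHt v : adjoint ip (ad br H) v \in g0.
  by rewrite mem_perp adjointPr adE (brxx Lbr) ip0r.
have adH v : ad br H v \in g0 by rewrite adE sol_br_g0.
have [Hp HE] := mean_curvP mr.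
move=> xp yp; set F := res_end g0 (ad br H).
have FE v : vsval (F v) = br H (vsval v) by rewrite res_endE // adE.
have trF : trl F = ip H H by rewrite HE; apply: trl_restrict => // v; rewrite res_endE.
have ext : ricform br ip p (vsval x) (vsval y) = ricform br0 ip0 p0 x y
    - 2^-1 * (trl F / ip H H) * (ip0 (F x) y + ip0 x (F y)).
  apply: (ricform_ext sol_mr0 mr) => //.
  - by move=> v w; apply: esym (res_bracketE sol_br_g0 v w).
  - by move=> v; have := subvsP v; rewrite mem_perp ipC => /eqP.
  - exact: g0_span.
  - by move=> z; rewrite mem_res_vspace.
  - by move=> z; rewrite mem_res_vspace.
  - by move=> v; apply: esym (FE v).
  - exact: sol_g0_unimodular.
  - by move=> v w; rewrite /= /res_ip !adjoint_res // !FE sol_ad_normal.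
  move=> z; rewrite mem_res_vspace => zk; apply: subvs_inj.
  by rewrite FE (ad_mean_curv_k mr).
rewrite !mem_res_vspace in xp yp.
have Dp : D (vsval x) \in p by apply: (as_p sol).
have [ricD _] := ricci_eqP mr xp (rpredD (memvZ c xp) Dp).
have := ricD (as_ricci sol xp) _ yp; rewrite ext trF => /eqP.
rewrite subr_eq => /eqP ->; rewrite /= /res_ip !FE.
rewrite add_lfunE opp_lfunE !(ipDl, ipNl, ipZl) ip_symm !adE.
(* In the unimodular case g0 is all of g and the coefficient is 0 / 0 = 0, but ad H vanishes as
   well. *)
have [H0|H0] := eqVneq H 0.
  have brH v : br H v = 0 by rewrite H0 br0l.
  by rewrite !brH !(ip0l, ip0r); ring.
by rewrite divff ?ip_eq0 //; ring.
Qed.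

Lemma sol_restrict : algebraic_soliton_with br0 ip0 k0 p0 c
  (res_end g0 D + res_end g0 SH).
Proof.
have D0E : D + SH = D0 by rewrite addrAC addNr add0r.
set D' := res_end g0 D + res_end g0 SH.
have valE v : vsval (D' v) = D0 (vsval v).
  by rewrite /D' res_endD D0E res_endE // sol_D0_g0.
have D0p v : v \in p -> D0 v \in p.
  move=> vp; apply/(mem_pP mr) => z zk.
  by rewrite sol_D0_sym D0_k // ip0r.
split.
- move=> x y; apply: subvs_inj.
  transitivity (vsval (br0 (D' x) y) + vsval (br0 x (D' y))); last by [].
  rewrite valE.
  by rewrite !(res_bracketE sol_br_g0) !valE D0_der.
- by apply/symmP => x y; rewrite /= /res_ip !valE sol_D0_sym.
- move=> z; rewrite mem_res_vspace => zk; apply: subvs_inj.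
  by rewrite valE D0_k.
- by move=> x; rewrite !mem_res_vspace valE; apply: D0p.
move=> x xp; apply/(ricci_eqP sol_mr0) => //.
  rewrite rpredD ?memvZ // mem_res_vspace valE D0p //.
  by rewrite -mem_res_vspace.
by move=> y yp; rewrite sol_ricform0 // ipDl ipZl /= /res_ip valE.
Qed.

Lemma trl_res_D0 : trl (res_end g0 D0) = trl D0.
Proof. by apply: trl_restrict => v; rewrite ?res_endE ?sol_D0_g0. Qed.

Lemma trl_res_D0_sq : trl (res_end g0 D0 \o res_end g0 D0)%VF = trl (D0 \o D0)%VF.
Proof.
by apply: trl_restrict => v; rewrite !comp_lfunE ?res_endE ?sol_D0_g0.
Qed.

Lemma trl_res_ad_D0 x : trl (ad br0 x \o res_end g0 D0)%VF = 0.
Proof.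
rewrite (@trl_restrict _ _ _ (ad br (vsval x) \o D0)%VF).
- by rewrite trlC D0_ad //; have := subvsP x; rewrite mem_perp => /eqP.
- by move=> v; rewrite comp_lfunE adE sol_br_g0.
by move=> v; rewrite !comp_lfunE !adE (res_bracketE sol_br_g0) res_endE ?sol_D0_g0.
Qed.

Section ReplacedBracket.
Hypothesis H_neq0 : H != 0.
Hypothesis D0_gt0 : 0 < trl D0.
Local Notation alpha := (normv ip H / Num.sqrt (trl D0)).
Local Notation E := (alpha *: D0).
Local Notation brE := (replace_ad br ip H E).

Let HH : ip H H != 0. Proof. by rewrite ip_eq0. Qed.

Let alpha_sqr : alpha ^+ 2 = ip H H / trl D0.
Proof. by rewrite sqr_div_sqrt ?ip_ge0 // ltW. Qed.

Let coef_g0 v : v \in g0 -> coef_on ip H v = 0.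
Proof. by rewrite mem_perp /coef_on => /eqP ->; rewrite mul0r. Qed.

Let perp_id v : v \in g0 -> perp_part ip H v = v.
Proof. by move=> vg; rewrite /perp_part coef_g0 // scale0r subr0. Qed.

Let E_g0 v : E v \in g0.
Proof. by rewrite scale_lfunE memvZ // sol_D0_g0. Qed.

Let E_der : derivation br E.
Proof. by move=> x y; rewrite !scale_lfunE D0_der scalerDr brZl brZr. Qed.

Let brE_g0 x y : brE x y \in g0.
Proof. by rewrite /replace_ad /= rpredD ?sol_br_g0 // rpredB // memvZ // E_g0. Qed.

(** k acts as before, since it commutes with H and is killed by D0. *)
Let brE_k z x : z \in k -> brE z x = br z x.
Proof.
move=> zk; have zg : z \in g0 := subvP sol_k_g0 z zk.
rewrite /replace_ad /= perp_id // coef_g0 // scale0r sub0r.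
rewrite scale_lfunE D0_k // !scaler0 oppr0 addr0 /perp_part brDr brNr brZr.
by rewrite (brC Lbr z H) (ad_mean_curv_k mr) // oppr0 scaler0 subr0.
Qed.

Lemma replace_ad_metric_reductive : metric_reductive brE ip k p.
Proof.
split; try by case: mr.
- split=> [x|x y z].
    by rewrite /= /replace_ad (brxx Lbr) subrr addr0.
  have := derivation_ext_jacobi ip Lbr E_der (coef_on ip H x) (coef_on ip H y)
    (coef_on ip H z) (perp_part ip H x) (perp_part ip H y) (perp_part ip H z).
  rewrite /= => jac; rewrite /= ![replace_ad br ip H E _ (replace_ad _ _ _ _ _ _)]/replace_ad.
  by rewrite !(perp_id (brE_g0 _ _)) !(coef_g0 (brE_g0 _ _)) /=.
- by move=> x y xk yk; have := mr_subalg mr xk yk; rewrite -(brE_k _ xk).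
- by move=> x y xk yk; have := mr_stable mr xk yk; rewrite -(brE_k _ xk).
by move=> z zk x y; have := mr_skew mr zk x y; rewrite -!(brE_k _ zk).
Qed.

Lemma replace_ad_einstein : einstein_with brE ip k p c.
Proof.
pose F := alpha *: res_end g0 D0.
have FE v : vsval (F v) = alpha *: D0 (vsval v).
  by rewrite scale_lfunE /= res_endE // sol_D0_g0.
have F_sym x y : ip0 (F x) y = ip0 x (F y).
  by rewrite /= /res_ip !FE ipZl ipZr sol_D0_sym.
have trF : trl F = alpha * trl D0 by rewrite trlZ trl_res_D0.
have [Hp HE] := mean_curvP mr.
(* Both conditions of [einstein_ext] involve alpha only through its square. *)
have aa : alpha * alpha = ip H H / trl D0 by rewrite -expr2 alpha_sqr.
have t0 : trl D0 != 0 by rewrite gt_eqF.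
apply: (einstein_ext (F := F) (i := vsval) (A := H) sol_mr0
  replace_ad_metric_reductive) => //.
- move=> v w; rewrite /= /replace_ad !(perp_id (subvsP _)) !(coef_g0 (subvsP _)).
  by rewrite !scale0r subrr addr0 (res_bracketE sol_br_g0).
- by move=> v; have := subvsP v; rewrite mem_perp ipC => /eqP.
- exact: g0_span.
- by move=> z; rewrite mem_res_vspace.
- by move=> z; rewrite mem_res_vspace.
- move=> v; rewrite /= /replace_ad FE (perp_id (subvsP _)) (coef_g0 (subvsP _)).
  rewrite /coef_on divff // /perp_part /coef_on divff // scale1r subrr br0l.
  by rewrite add0r scale1r scale0r subr0 scale_lfunE.
- exact: sol_g0_unimodular.
- by move=> v w; rewrite !(adjoint_eq F_sym).
- by move=> z; rewrite mem_res_vspace => zk; apply: subvs_inj; rewrite FE D0_k ?scaler0.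
- by move=> x _; rewrite /F -comp_lfunZr trlZ trl_res_ad_D0 mulr0.
- move=> x y xp yp; rewrite sol_ricform0 // trF {2}/res_ip /= /res_ip FE ipZl.
  congr (_ + _).
  transitivity (alpha * alpha * (trl D0 / ip H H) * ip (D0 (vsval x)) (vsval y)).
    by rewrite aa mulrA divfK // divff // mul1r.
  by ring.
rewrite /F -comp_lfunZl -comp_lfunZr !trlZ mulrA aa trl_res_D0_sq D0_sq.
by rewrite mulrCA divfK.
Qed.

End ReplacedBracket.

Section LineExtension.
Hypothesis uni : unimodular br.
Hypothesis D0_gt0 : 0 < trl D0.
Local Notation alpha := (Num.sqrt (trl D0))^-1.
Local Notation E := (alpha *: D0).
Local Notation brE := (sd_bracket (line_bracket R) br (line_act E)).
Local Notation ipE := (sum_ip (line_ip R) ip).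
Local Notation kE := (prodv (0 : {vspace R^o})%VS k).
Local Notation pE := (prodv {:R^o}%VS p).

Lemma unimodular_mean_curv : H = 0.
Proof. by apply: (mean_curv_eq mr); rewrite ?mem0v // => x _; rewrite ip0l uni. Qed.

Lemma unimodular_SH : SH = 0.
Proof.
apply/lfunP => x; rewrite zero_lfunE; apply: (@ip_inj _ _ ip) => y.
by rewrite ip_symm !adE unimodular_mean_curv !br0l !(ip0l, ip0r) addr0 mulr0.
Qed.

Let E_der : derivation br E.
Proof. by move=> x y; rewrite !scale_lfunE D0_der scalerDr brZl brZr. Qed.

Let brEE (s t : R^o) v w : brE (s, v) (t, w) = (0, br v w + (s *: E w - t *: E v)).
Proof.
by congr pair; rewrite /= /line_act !scale_lfunE addrC.
Qed.

Let brE_k z x : z \in k -> brE (0, z) x = (0, br z x.2).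
Proof.
move=> zk; case: x => t x; rewrite brEE scale0r sub0r.
by rewrite scale_lfunE D0_k // !scaler0 oppr0 addr0.
Qed.

Let ipEE (s t : R^o) v w : ipE (s, v) (t, w) = s * t + ip v w.
Proof. by []. Qed.

Lemma line_ext_metric_reductive : metric_reductive brE ipE kE pE.
Proof.
have kEP (x : (R^o * V)%type) : x \in kE -> x = (0, x.2) /\ x.2 \in k.
  by case: x => s v; rewrite mem_prodv memv0 /= => /andP[/eqP -> vk].
split.
- split=> [[s v]|[r x] [s y] [t z]].
    by rewrite /= brEE subrr (brxx Lbr) addr0.
  rewrite /= !brEE; congr pair; first by rewrite /= !addr0.
  exact: (derivation_ext_jacobi ip Lbr E_der).
- apply/eqP; rewrite eqEsubv subvf; apply/subvP => -[s v] _.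
  apply/memv_addP; exists (0, daddv_pi k p v); first by rewrite mem_prodv mem0v memv_pi.
  exists (s, daddv_pi p k v); first by rewrite mem_prodv memvf memv_pi.
  by congr pair; rewrite /= ?add0r // addrC -(mr_decomp mr).
- apply/eqP; rewrite -subv0; apply/subvP => -[s v].
  rewrite memv_cap !mem_prodv /= memv0 memvf /= => /andP[/andP[/eqP -> vk] vp].
  have : v \in (k :&: p)%VS by rewrite memv_cap vk.
  by rewrite (mr_direct mr) !memv0 => /eqP ->.
- move=> x y /kEP[-> xk] /kEP[-> yk].
  rewrite [X in X \in _](brE_k _ xk) mem_prodv mem0v /=; exact: (mr_subalg mr).
- move=> x [s y] /kEP[-> xk]; rewrite mem_prodv => /andP[_ /= yp].
  rewrite [X in X \in _](brE_k _ xk) mem_prodv memvf /=; exact: (mr_stable mr).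
- move=> x [s y] /kEP[-> xk]; rewrite mem_prodv => /andP[_ /= yp].
  by rewrite [LHS]ipEE mul0r add0r (mr_ortho mr).
move=> z /kEP[-> zk] [s x] [t y].
transitivity (ipE (0, br z.2 x) (t, y)); first by rewrite -(brE_k (s, x) zk).
transitivity (- ipE (s, x) (0, br z.2 y)); last by rewrite -(brE_k (t, y) zk).
by rewrite !ipEE mul0r mulr0 !add0r (mr_skew mr).
Qed.

Lemma line_ext_einstein : einstein_with brE ipE kE pE c.
Proof.
have [j jE] : exists j : 'Hom(V, (R^o * V)%type), forall v, j v = (0, v).
  apply: lfun_exists => a u v; congr pair => /=.
  by rewrite scaler0 addr0.
have t0 : trl D0 != 0 by rewrite gt_eqF.
have aa : alpha * alpha = (trl D0)^-1.
  by rewrite -expr2 exprVn sqr_sqrtr // ltW.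
have E_sym x y : ip (E x) y = ip x (E y).
  by rewrite !scale_lfunE ipZl ipZr sol_D0_sym.
pose A : (R^o * V)%type := (1, 0).
pose ipS : {dot (R^o * V)%type for @idfun R} := ipE.
have AA : ipS A A = 1 by rewrite [LHS]ipEE ip0l addr0 mulr1.
apply: (einstein_ext (F := E) (i := j) (A := A) mr line_ext_metric_reductive).
- by move=> x y; rewrite /= !jE [LHS]ipEE mul0r add0r.
- move=> x y; rewrite /= !jE; apply: etrans (brEE _ _ _ _) _.
  by rewrite !scale0r subrr addr0.
- by move=> x; rewrite /= jE [LHS]ipEE mulr0 add0r ip0l.
- by rewrite mem_prodv memvf mem0v.
- move=> [s v]; exists v; rewrite AA divr1 /= jE.
  have -> : ipS (s, v) A = s by rewrite [LHS]ipEE mulr1 ip0r addr0.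
  congr pair; rewrite /=; first by rewrite add0r [RHS]mulr1.
  by rewrite scaler0 addr0.
- by move=> z zk; rewrite /= jE mem_prodv mem0v.
- by move=> x xp; rewrite /= jE mem_prodv memvf.
- move=> x; rewrite /= !jE; apply: etrans (brEE _ _ _ _) _.
  by rewrite br0l add0r scale1r scale0r subr0.
- exact: uni.
- by move=> v w; rewrite !(adjoint_eq E_sym).
- by move=> z zk; rewrite scale_lfunE D0_k // scaler0.
- exact: E_sym.
- move=> x _; rewrite -comp_lfunZr trlZ trlC D0_ad ?mulr0 //.
  by rewrite unimodular_mean_curv ip0r.
- move=> x y xp yp; rewrite [X in _ / X]AA divr1 scale_lfunE ipZl trlZ.
  have DE : D = D0 by rewrite unimodular_SH oppr0 add0r.
  have D0p : D0 x \in p by rewrite -DE; apply: (as_p sol).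
  have ricx : ricci br ip k p x = c *: x + D0 x by rewrite (as_ricci sol) // DE.
  have [ricD _] := ricci_eqP mr xp (rpredD (memvZ c xp) D0p).
  rewrite (ricD ricx _ yp) ipDl ipZl; congr (_ + _).
  by rewrite mulrACA aa mulrA mulVf // mul1r.
rewrite [X in _ * X]AA mulr1 -comp_lfunZl -comp_lfunZr !trlZ mulrA aa D0_sq.
by rewrite mulrCA mulVf // mulr1.
Qed.

End LineExtension.

End AlgebraicSoliton.

(** * The semidirect product of the construction *)

Section Construction.
Variables (R : realType) (n u : vectType R).
Variables (brn : {bilinear n -> n -> n}) (ipn : {dot n for @idfun R}).
Variables (bru : {bilinear u -> u -> u}) (ipu : {dot u for @idfun R}).
Variables (k h : {vspace u}) (theta : {linear u -> 'End(n)}).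
Variables (c : R) (D1 : 'End(n)).
Hypothesis cd : construction_data brn ipn bru ipu k h theta c D1.

Local Notation g := (u * n)%type.
Let br : {bilinear g -> g -> g} := sd_bracket bru brn theta.
Let ip : {dot g for @idfun R} := sum_ip ipu ipn.
Local Notation kg := (prodv k (0 : {vspace n})%VS).
Local Notation pg := (prodv h {:n}%VS).
Local Notation H := (mean_curv br ip pg).
Local Notation SH := (symm ip (ad br H)).
Local Notation D0 := (block2 u D1).
Local Notation D := (- SH + D0).

Let ns := cd_n cd.
Let mru := cd_u cd.

Lemma sd_bracketE y v z w : br (y, v) (z, w) =
  (bru y z, theta y w - theta z v + brn v w).
Proof. by []. Qed.

Lemma sum_ipE y v z w : ip (y, v) (z, w) = ipu y z + ipn v w.
Proof. by []. Qed.

Lemma block2E x : D0 x = (0, D1 x.2).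
Proof. by rewrite /block2 lfunE. Qed.

(** [ns_commute] needs theta(y)^t to be a derivation: on an orthonormal basis of h this comes from
    (c2), and on k from (c1), where theta(z)^t = -theta(z). *)
Lemma theta_commute y w : theta y (D1 w) = D1 (theta y w).
Proof.
have comm z : derivation brn (adjoint ipn (theta z)) ->
    theta z (D1 w) = D1 (theta z w).
  by move=> dz; rewrite -!comp_lfunE (ns_commute ns (cd_der cd z) dz).
rewrite (mr_decomp mru y) linearD !add_lfunE linearD; congr (_ + _).
  rewrite (onb_expand ipu (memv_pi h k y)) linear_sum !sum_lfunE linear_sum.
  apply: eq_big_seq => a aX.
  rewrite linearZ !scale_lfunE linearZ comm //.
  apply: (ns_adjoint_derivation ns (s := onb ipu h) (E := theta)) => //.
    by move=> b; apply: cd_der cd b.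
  exact: (cd_c2 cd (onbP ipu h)).
apply: comm; rewrite (cd_c1 cd (memv_pi k h y)) => v w'.
by rewrite !opp_lfunE (cd_der cd) opprD brNl brNr.
Qed.

Lemma block2_derivation : derivation br D0.
Proof.
move=> [y v] [z w]; rewrite !block2E /= !sd_bracketE; congr pair => /=.
  by rewrite br0l br0r addr0.
rewrite linear0 !zero_lfunE !linearD linearN /= (ns_der ns) !theta_commute.
apply: (@ip_inj _ _ ipn) => x; rewrite !(ipDl, ipNl) ip0l; ring.
Qed.

Hypothesis mr : metric_reductive br ip kg pg.
Hypothesis sol : algebraic_soliton_with br ip kg pg c D.

Lemma trl_ad_sd y v : trl (ad br (y, v)) = trl (ad bru y) + trl (theta y).
Proof.
rewrite (@trl_prod _ _ _ ipu ipn _ (ad bru y) (theta y + ad brn v)).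
- by rewrite trlD (nil_trl_ad (ns_nil ns)) addr0.
- by move=> a; rewrite !adE.
by move=> b; rewrite add_lfunE !adE sd_bracketE /= linear0 zero_lfunE subr0.
Qed.

Lemma mean_curv_sd : H.2 = 0.
Proof.
have [_ HE] := mean_curvP mr; apply: (@ip_inj _ _ ipn) => v; rewrite ip0l.
have := HE (0, v); rewrite trl_ad_sd linear0 trl0 addr0.
have -> : ad bru 0 = 0 by apply/lfunP => w; rewrite adE br0l zero_lfunE.
by rewrite trl0; case: H => y w; rewrite sum_ipE ip0r add0r.
Qed.

Lemma block2_mean_curv : D0 H = 0.
Proof. by rewrite block2E mean_curv_sd linear0. Qed.

Lemma block2_k : {in kg, forall z, D0 z = 0}.
Proof.
by move=> z; rewrite mem_prodv memv0 => /andP[_ /eqP z0]; rewrite block2E z0 linear0.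
Qed.

Lemma trl_block2 (T : 'End(n)) : trl (block2 u T) = trl T.
Proof.
rewrite (@trl_prod _ _ _ ipu ipn _ 0 T) ?trl0 ?add0r // => a.
  by rewrite lfunE /= zero_lfunE.
by rewrite lfunE.
Qed.

Lemma trl_block2_sq : trl (D0 \o D0)%VF = - c * trl D0.
Proof.
rewrite trl_block2 -(ns_trl_derivation ns (ns_der ns)) -[RHS]trl_block2.
by congr trl; apply/lfunP => x; rewrite !comp_lfunE !lfunE /= /block2_fun comp_lfunE.
Qed.

Let sum_onb_sd (f : g -> g -> R) :
  (forall y, scalar (f^~ y)) -> (forall x, scalar (f x)) ->
  \sum_(a <- onb ip pg) f a a =
  \sum_(a <- onb ipu h) f (a, 0) (a, 0)
  + \sum_(b <- onb ipn fullv) f (0, b) (0, b).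
Proof.
move=> fl fr.
pose e (o : u + n) : g :=
  match o with inl a => (if a \in h then a else 0, 0) | inr b => (0, b) end.
rewrite (@sum_onb_frame _ _ ip pg f _
  (map inl (onb ipu h) ++ map inr (onb ipn fullv)) (fun=> 1) e) //.
- rewrite big_cat !big_map /=; congr (_ + _).
    by apply: eq_big_seq => a /onb_mem aX; rewrite mul1r aX.
  by apply: eq_bigr => b _; rewrite mul1r.
- move=> [a|b]; rewrite mem_prodv /= ?mem0v ?memvf ?andbT //.
  by case: ifP => // _; rewrite mem0v.
move=> [y v]; rewrite mem_prodv => /andP[/= yh _].
rewrite big_cat !big_map /=.
transitivity ((y, 0) + (0, v) : g); first by congr pair; rewrite /= ?addr0 ?add0r.
congr (_ + _).
  transitivity ((\sum_(a <- onb ipu h) ipu y a *: a, 0) : g).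
    by rewrite -onb_expand.
  rewrite big_seq [RHS]big_seq.
  elim/big_ind2: _ => [//|a a' b b' <- <-|a aX].
    by congr pair; rewrite /= addr0.
  rewrite (onb_mem aX) sum_ipE ip0r addr0 mul1r.
  by congr pair; rewrite /= scaler0.
transitivity ((0, \sum_(a <- onb ipn fullv) ipn v a *: a) : g).
  by rewrite -onb_expand // memvf.
elim/big_ind2: _ => [//|a a' b b' <- <-|a aX].
  by congr pair; rewrite /= addr0.
rewrite sum_ipE ip0r add0r mul1r.
by congr pair; rewrite /= scaler0.
Qed.

Lemma killing_sd y : killing br (y, 0) (y, 0) =
  killing bru y y + trl (theta y \o theta y)%VF.
Proof.
rewrite /killing; apply: (trl_prod ipu ipn) => a.
  by rewrite !comp_lfunE !adE.
rewrite !comp_lfunE !adE !sd_bracketE /= !br0l !br0r !addr0.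
by rewrite !linear0 !addr0.
Qed.

(** The new term comes from [(y, 0), (0, b)] = (0, theta(y) b). The second sum of M gains nothing,
    as a bracket with an entry in n has no u-component. *)
Lemma mform_sd y : mform br ip pg (y, 0) (y, 0) =
  mform bru ipu h y y - 2^-1 * trl (adjoint ipn (theta y) \o theta y)%VF.
Proof.
have inner v w : \sum_(b <- onb ip pg) ip v b * ip w b =
    \sum_(b <- onb ipu h) ipu v.1 b * ipu w.1 b + ipn v.2 w.2.
  rewrite (@sum_onb_sd (fun b b' => ip v b * ip w b')).
  - rewrite -(onb_parseval ipn w.2 (memvf v.2)).
    case: v w => [v1 v2] [w1 w2] /=; congr (_ + _); apply: eq_bigr => b _;
      by rewrite !sum_ipE !ip0r ?addr0 ?add0r.
  - by move=> b; apply: scalarMr; apply: scalar_ip.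
  by move=> b; apply: scalarM; apply: scalar_ip.
rewrite /mform.
have -> : \sum_(a <- onb ip pg) \sum_(b <- onb ip pg)
    ip (br (y, 0) a) b * ip (br (y, 0) a) b
  = \sum_(a <- onb ipu h) \sum_(b <- onb ipu h) ipu (bru y a) b * ipu (bru y a) b
  + trl (adjoint ipn (theta y) \o theta y)%VF.
  rewrite (@sum_onb_sd (fun a a' => \sum_(b <- onb ip pg)
     ip (br (y, 0) a) b * ip (br (y, 0) a') b)).
  - congr (_ + _).
      apply: eq_bigr => a _; by rewrite inner /= !linear0 ?addr0 ?ip0l ?addr0.
    rewrite (trl_onb ipn); apply: eq_bigr => b _; rewrite inner /= br0r.
    rewrite big1 => [|a _]; last by rewrite ip0l mulr0.
    by rewrite add0r !linear0 addr0 br0l addr0 comp_lfunE adjointPr.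
  - move=> a; apply: scalar_sum => b; apply: scalarMr => s v w.
    by rewrite brDr brZr ipDl ipZl.
  move=> a; apply: scalar_sum => b; apply: scalarM => s v w.
  by rewrite brDr brZr ipDl ipZl.
have -> : \sum_(a <- onb ip pg) \sum_(b <- onb ip pg)
    ip (br a b) (y, 0) * ip (br a b) (y, 0)
  = \sum_(a <- onb ipu h) \sum_(b <- onb ipu h) ipu (bru a b) y * ipu (bru a b) y.
  rewrite (@sum_onb_sd (fun a a' => \sum_(b <- onb ip pg)
     ip (br a b) (y, 0) * ip (br a' b) (y, 0))).
  - rewrite [X in _ + X]big1 ?addr0 => [|a _]; last first.
      rewrite big1 // => -[b v] _.
      by rewrite [br _ _]sd_bracketE sum_ipE br0l ip0l ip0r addr0 mulr0.
    apply: eq_bigr => a _.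
    rewrite (@sum_onb_sd (fun b b' => ip (br (a, 0) b) (y, 0) * ip (br (a, 0) b') (y, 0))).
    + rewrite [X in _ + X]big1 ?addr0 => [|b _]; last first.
        by rewrite sd_bracketE sum_ipE br0r ip0l ip0r addr0 mulr0.
      by apply: eq_bigr => b _; rewrite sd_bracketE sum_ipE ip0r addr0.
    + by move=> b; apply: scalarMr => s v w; rewrite brDr brZr ipDl ipZl.
    by move=> b; apply: scalarM => s v w; rewrite brDr brZr ipDl ipZl.
  - move=> a; apply: scalar_sum => b; apply: scalarMr => s v w.
    by rewrite brDl brZl ipDl ipZl.
  move=> a; apply: scalar_sum => b; apply: scalarM => s v w.
  by rewrite brDl brZl ipDl ipZl.
by ring.
Qed.

(** For T = theta(y) this is minus the sum of the terms that n adds to M and to -B/2 at (y, 0), so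
    it matches C_theta in (c3). *)
Lemma trl_symm_sq (T : 'End(n)) : trl (symm ipn T \o symm ipn T)%VF =
  2^-1 * (trl (T \o T)%VF + trl (adjoint ipn T \o T)%VF).
Proof.
rewrite /symm -comp_lfunZl -comp_lfunZr !trlZ !comp_lfunDl !comp_lfunDr !trlD.
have -> : trl (adjoint ipn T \o adjoint ipn T)%VF = trl (T \o T)%VF.
  rewrite -[RHS](trl_adjoint ipn); congr trl; apply/esym/adjoint_eq => x y.
  by rewrite !comp_lfunE !adjointP.
by rewrite [trl (T \o adjoint _ _)%VF]trlC; field.
Qed.

(* Comparing the Ricci operators of u and g on h leaves
   <[H_u, y], y> = 0, whence |H_u|^2 = tr ad H_u = 0. *)
Lemma unimodular_u : unimodular bru.
Proof.
set Hu := mean_curv bru ipu h.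
have [Huh HuE] := mean_curvP mru; rewrite -/Hu in Huh HuE.
have skew y : y \in h -> ipu (bru Hu y) y = 0.
  move=> yh; have [C [Ch _ Csq ricu]] := cd_c3 cd.
  have y0p : (y, 0) \in pg by rewrite mem_prodv /= yh memvf.
  have [ru _] := ricci_eqP mru yh (rpredD (memvZ c yh) (Ch y yh)).
  have := ru (ricu y yh) y yh; rewrite ipDl ipZl Csq // trl_symm_sq.
  have [rg _] := ricci_eqP mr y0p (rpredD (memvZ c y0p) (as_p sol y0p)).
  have := rg (as_ricci sol y0p) _ y0p.
  rewrite /ricform mform_sd killing_sd ipDl ipZl add_lfunE opp_lfunE ipDl ipNl.
  have -> : D0 (y, 0) = 0 by rewrite block2E linear0.
  rewrite ip_symm !adE ip0l addr0 [ip (y, 0) (y, 0)]sum_ipE ip0l addr0.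
  rewrite -/Hu [ipu y (bru Hu y)]ipC.
  move: (killing _ _ _) (mform _ _ _ _ _) (ip _ _) (ip _ _) (trl _) (trl _)
    (ipu _ _) (ipu _ _) => K M a b s t d e *.
  lra.
have tr0 : ipu Hu Hu = 0.
  rewrite HuE (trl_onb ipu) -(@sum_onb_p _ _ _ _ _ _ mru (fun x y => ipu (ad bru Hu x) y)).
  - by rewrite big_seq big1 // => a /onb_mem ah; rewrite adE skew.
  - by move=> y; apply: scalar_ipl.
  - by move=> x; apply: scalar_ip.
  by move=> z zk; rewrite adE (ad_mean_curv_k mru) // ip0l.
move/eqP: tr0; rewrite ip_eq0 => /eqP Hu0 x.
by rewrite -HuE Hu0 ip0l.
Qed.

(** As u is unimodular, tr ad x = tr theta(y), which is 0 for x orthogonal to H. Then tr(D1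
    theta(y)) = -c tr theta(y) = 0, and the part of x in n contributes 0 by nilpotency. *)
Lemma trl_block2_ad x : ip x H = 0 -> trl (D0 \o ad br x)%VF = 0.
Proof.
have [_ HE] := mean_curvP mr.
case: x => y v; rewrite ipC HE trl_ad_sd unimodular_u add0r => tr0.
rewrite (@trl_prod _ _ _ ipu ipn _ 0 ((D1 \o theta y) + (D1 \o ad brn v))%VF).
- rewrite trlD (nil_trl_der_ad (ns_nil ns) v (ns_der ns)) trl0.
  by rewrite (ns_trl_derivation ns (cd_der cd y)) tr0 mulr0 !addr0.
- by move=> a; rewrite comp_lfunE block2E zero_lfunE.
move=> b; rewrite comp_lfunE block2E adE /= linear0 zero_lfunE subr0.
by rewrite add_lfunE !comp_lfunE adE linearD.
Qed.

(** A non-unimodular g forces n to be nonzero: u being unimodular, a nonzero tr ad x can only come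
    from theta. *)
Lemma trl_block2_gt0 : ~ unimodular br \/ (0 < \dim {:n})%N -> 0 < trl D0.
Proof.
rewrite trl_block2 => h0; apply: (ns_trl_gt0 ns).
case: h0 => [nuni|]; last by rewrite lt0n dimv_eq0.
apply/eqP => n0; apply: nuni => -[y v]; rewrite trl_ad_sd unimodular_u add0r.
suff -> : theta y = 0 by rewrite trl0.
apply/lfunP => w; rewrite zero_lfunE; apply/eqP.
by rewrite -memv0 -n0 memvf.
Qed.

End Construction.

Theorem proposition6p1 (R : realType) (n u : vectType R)
    (brn : {bilinear n -> n -> n}) (ipn : {dot n for @idfun R})
    (bru : {bilinear u -> u -> u}) (ipu : {dot u for @idfun R})
    (k h : {vspace u}) (theta : {linear u -> 'End(n)})
    (c : R) (D1 : 'End(n)) :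
  construction_data brn ipn bru ipu k h theta c D1 ->
  let br : {bilinear (u * n)%type -> (u * n)%type -> (u * n)%type} :=
    sd_bracket bru brn theta in
  let ip : {dot (u * n)%type for @idfun R} := sum_ip ipu ipn in
  let kg := prodv k (0 : {vspace n})%VS in
  let pg := prodv h {:n}%VS in
  let H := mean_curv br ip pg in
  let SH := symm ip (ad br H) in
  let D0 := block2 u D1 in
  let D := - SH + D0 in
  let g0 := orthov ip <[H]>%VS in
  metric_reductive br ip kg pg ->
  {in kg & pg, forall z x, killing br z x = 0} ->
  algebraic_soliton_with br ip kg pg c D ->
  [/\ stable br fullv g0, unimodular (res_bracket g0 br) &
    [/\ (* (i) *)
        ~ unimodular br ->
        let alpha := normv ip H / Num.sqrt (trl D1) in
        let E := alpha *: (SH + D) in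
        [/\ E = alpha *: D0,
            metric_reductive (replace_ad br ip H E) ip kg pg &
            einstein_with (replace_ad br ip H E) ip kg pg c],
        (* (ii) *)
        [/\ (kg <= g0)%VS, {in g0, forall x, D x \in g0},
            {in g0, forall x, SH x \in g0} &
            let br0 := res_bracket g0 br in
            let ip0 := res_ip g0 ip in
            let k0 := res_vspace g0 kg in
            let p0 := res_vspace g0 pg in
            metric_reductive br0 ip0 k0 p0 /\
            algebraic_soliton_with br0 ip0 k0 p0 c
              (res_end g0 D + res_end g0 SH)]
      & (* (iii) *)
        unimodular br -> (0 < \dim {:n})%N ->
        let alpha := (Num.sqrt (trl D1))^-1 in
        let E := alpha *: D in
        let brt := sd_bracket (line_bracket R) br (line_act E) in
        let ipt := sum_ip (line_ip R) ip in
        let kt := prodv (0 : {vspace R^o})%VS kg in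
        let pt := prodv {:R^o}%VS pg in
        [/\ E = alpha *: D0,
            metric_reductive brt ipt kt pt &
            einstein_with brt ipt kt pt c]]].
Proof.
move=> cd br ip kg pg H SH D0 D g0 mr _ sol.
have D0_der : derivation br D0 := block2_derivation cd.
have D0_k : {in kg, forall z, D0 z = 0} := block2_k (k := k) D1.
have D0_H : D0 H = 0 := block2_mean_curv cd mr.
have D0_ad x : ip x H = 0 -> trl (D0 \o ad br x)%VF = 0 by apply: trl_block2_ad cd mr sol x.
have D0_sq : trl (D0 \o D0)%VF = - c * trl D0 := trl_block2_sq cd.
have trD0 : trl D0 = trl D1 := trl_block2 ipn ipu D1.
have SHD : SH + D = D0 by rewrite /D addrA subrr add0r.
split; [|exact: (sol_g0_unimodular mr)|split].
- by move=> x y _ _; apply: (sol_br_g0 mr).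
- move=> nuni alpha E; have EE : E = alpha *: D0 by rewrite /E SHD.
  have gt0 : 0 < trl D0 by apply: (trl_block2_gt0 cd mr sol); left.
  have H0 : H != 0.
    apply/eqP => H0; apply: nuni => x; have [_ <-] := mean_curvP mr.
    by rewrite -/H H0 ip0l.
  split=> //; rewrite EE /alpha -trD0.
    exact: (replace_ad_metric_reductive mr sol).
  exact: (replace_ad_einstein mr sol).
- split=> [||x _|].
  + exact: sol_k_g0 mr.
  + by move=> x _; apply: (sol_D_g0 mr sol).
  + exact: (sol_SH_g0 mr sol).
  split; first exact: sol_mr0 mr.
  exact: (sol_restrict mr sol).
move=> uni n0 alpha E.
have gt0 : 0 < trl D0 by apply: (trl_block2_gt0 cd mr sol); right.
have EE : E = alpha *: D0 by rewrite /E /D /SH (unimodular_SH mr uni) oppr0 add0r.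
split=> //; rewrite EE /alpha -trD0.
  exact: (line_ext_metric_reductive mr D0_der D0_k).
exact: (line_ext_einstein mr sol).
Qed.
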